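(* Let $\lambda\in\Lambda[0,T]$, $1\le p<2$, $\sigma>0$, $K>0$ and $r>0$. Let $X$ be a subset of $X_{\lambda,p,\sigma}[0,T]$ and let $P=\mathcal E_\lambda(X)=\{\mathcal E_\lambda(w):w\in X\}$. Let $Q(t)=e^{rt}$, $0\le t\le T$. Then $(\alpha,\beta)$ is a self-financing $\lambda$-trading strategy for the portfolio $(Q,P)$; that is, for every price scenario $P=\mathcal E_\lambda(w)$, $w\in X$, the pair $(\alpha,\beta)$ defined from $P$ in the context is a $\lambda$-trading strategy for $(Q,P)$ and is self-financing.
   Context: Fix $T>0$. $\Lambda[0,T]$ is the set of sequences $\lambda=\{\lambda_m:m\ge1\}$ of partitions of $[0,T]$ with $\lambda_m\subset\lambda_{m+1}$ and $\bigcup_m\lambda_m$ dense in $[0,T]$. For $0\le u<v\le T$ let $\lambda_m|_{[u,v]}=\{u,v\}\cup(\lambda_m\cap(u,v))=\{u=x_0<\dots<x_n=v\}$. $CQ_{\lambda,\sigma}[0,T]$ is the class of continuous functions $g$ on $[0,T]$ having quadratic $\lambda$-variation with bracket $[g]_\lambda(t)=\sigma^2t$, i.e. $\lim_m\sum_i[g(x_i)-g(x_{i-1})]^2=\sigma^2(v-u)$ (sum over $\lambda_m|_{[u,v]}$) for all $0\le u<v\le T$. $C\mathcal W_p[0,T]$ is the class of continuous functions $h$ with bounded $p$-variation, $\sup\sum_i|h(t_i)-h(t_{i-1})|^p<\infty$ over partitions of $[0,T]$. Put $X_{\lambda,p,\sigma}[0,T]=\{g+h:g\in CQ_{\lambda,\sigma}[0,T],\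 h\in C\mathcal W_p[0,T],\ g(0)=h(0)=0\}$. Every $w\in X_{\lambda,p,\sigma}[0,T]$ belongs to $CQ_{\lambda,\sigma}[0,T]$, and its Doléans exponential is $\mathcal E_\lambda(w;t)=\exp\{w(t)-\tfrac12[w]_\lambda(t)\}=\exp\{w(t)-\tfrac12\sigma^2t\}$. Left Cauchy $\lambda$-integral on $[0,T)$ (for a continuous integrator $R$ on $[0,T]$ and a function $\gamma$ on $[0,T]$): $(LC)\int\gamma\,d_\lambda R$ is defined on $[0,T)$ if there is a regulated function $\Phi$ on $[0,T)$ with $\Phi(0)=0$, which has no jumps on $[0,T)$ (since $R$ has none), and for all $0\le u<v<T$, $\Phi(v)-\Phi(u)=\lim_m\sum_i\gamma(x_{i-1})[R(x_i)-R(x_{i-1})]$ (sum over $\lambda_m|_{[u,v]}$); then $(LC)\int_0^u\gamma\,d_\lambda R=\Phi(u)$, $0\le u<T$. Given continuous price scenarios $R_0,R_1$, functions $(\gamma_0,\gamma_1)$ on $[0,T]$ form a $\lambda$-trading strategy for $(R_0,R_1)$ if for $k=0,1$ the integral $(LC)\int\gamma_k\,d_\lambda R_k$ is defined on $[0,T)$ and the limit $\lim_{u\uparrow T}(LC)\int_0^u\gamma_k\,d_\lambda R_k=:(LC)\int_0^T\gamma_k\,d_\lambda R_k$ exists. Portfolio value: $V(t)=\sum_k\gamma_k(t)R_k(t)$; portfolio gain: $G(t)=\sum_k(LC)\int_0^t\gamma_k\,d_\lambda R_k$. The strategy is self-financing if $V(t)=V(0)+G(t)$ for all $t\in[0,T]$.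 The strategy $(\alpha,\beta)$: let $N$ be the standard normal distribution function and, for $t\in[0,T)$, $x>0$, $$d_1(t,x)=\frac{\ln(x/K)+(r+\sigma^2/2)(T-t)}{\sigma\sqrt{T-t}},\qquad d_2(t,x)=d_1(t,x)-\sigma\sqrt{T-t}.$$ Let $\phi(t,x)=xN(d_1(t,x))-Ke^{-r(T-t)}N(d_2(t,x))$ for $(t,x)\in[0,T)\times(0,\infty)$, $\phi(T,x)=\max\{0,x-K\}$ for $x>0$, and $\phi(t,0)=0$ for $t\in[0,T]$. For a price scenario $P=\mathcal E_\lambda(w)$ define $\beta(s)=N(d_1(s,P(s)))$ for $0\le s<T$, $\beta(T)=0$, and $\alpha(s)=\{\phi(s,P(s))-P(s)\beta(s)\}/Q(s)$ for $0\le s\le T$. Thus $V(s)=\alpha(s)Q(s)+\beta(s)P(s)=\phi(s,P(s))$. *)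

(* Defs.v *)
From HB Require Import structures.
From mathcomp Require Import all_boot all_order all_algebra.
From mathcomp Require Import all_classical all_reals all_analysis.

Set Implicit Arguments.
Unset Strict Implicit.
Unset Printing Implicit Defensive.

Import Order.TTheory GRing.Theory Num.Theory.
Import numFieldNormedType.Exports.

Local Open Scope classical_set_scope.
Local Open Scope ring_scope.

(* Functions on [0, T] are total functions R -> R of which only the values on
   [0, T] matter.  A partition u = x_0 < ... < x_n = v is represented, as in
   [itv_partition], by u together with the list [:: x_1; ...; x_n]. *)

Section partitions.
Context {R : realType}.
Implicit Types (T u v p t : R) (s : seq R) (lam : nat -> seq R)
  (f g h w H : R -> R).

(* The left endpoint 0, which is not stored in the lists, is a point of every
   partition. *)
Definition Lambda T lam : Prop :=
  [/\ forall m, itv_partition 0 T (lam m),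
      forall m, {subset lam m <= lam m.+1} &
      `[0, T] `<=` closure (\bigcup_m [set` 0 :: lam m])].

(* For 0 <= u < v <= T: the points x_1 < ... < x_n = v of {u, v} U (s n (u, v)),
   without u. *)
Definition restr_part s u v : seq R := rcons [seq x <- s | u < x < v] v.

Definition quad_sum f u s : R :=
  let x := u :: s in \sum_(0 <= i < size s) (f x`_i.+1 - f x`_i) ^+ 2.

Definition is_qvar T lam f H : Prop :=
  H 0 = 0 /\
  forall u v, 0 <= u -> u < v -> v <= T ->
    quad_sum f u (restr_part (lam m) u v) @[m --> \oo] --> H v - H u.

(* On [0, T], H as in [is_qvar] is unique if it exists. *)
Definition qbracket T lam f : R -> R :=
  xget (fun=> 0) [set H | is_qvar T lam f H].

Definition CQ T lam (sigma : R) g : Prop :=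
  {within `[0, T], continuous g} /\
  is_qvar T lam g (fun t => sigma ^+ 2 * t).

Definition pvar_sum p f u s : R :=
  let x := u :: s in
  \sum_(0 <= i < size s) `|f x`_i.+1 - f x`_i| `^ p.

Definition bounded_pvariation T p f : Prop :=
  has_ubound [set pvar_sum p f 0 s | s in itv_partition 0 T].

Definition CW T p h : Prop :=
  {within `[0, T], continuous h} /\ bounded_pvariation T p h.

Definition Xclass T lam p (sigma : R) : set (R -> R) :=
  [set w | exists g h, [/\ CQ T lam sigma g, CW T p h, g 0 = 0, h 0 = 0 &
     forall t, 0 <= t <= T -> w t = g t + h t]].

Definition doleans T lam w : R -> R :=
  fun t => expR (w t - 2^-1 * qbracket T lam w t).

End partitions.

Section left_cauchy.
Context {R : realType}.
Implicit Types (T t u v : R) (lam : nat -> seq R) (gamma S Phi : R -> R).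

Definition regulated_co T Phi : Prop :=
  (forall t, 0 <= t < T -> cvg (Phi x @[x --> t^'+])) /\
  (forall t, 0 < t < T -> cvg (Phi x @[x --> t^'-])).

Definition no_jumps_co T Phi : Prop :=
  (forall t, 0 <= t < T -> Phi x @[x --> t^'+] --> Phi t) /\
  (forall t, 0 < t < T -> Phi x @[x --> t^'-] --> Phi t).

Definition LC_sum gamma S u (s : seq R) : R :=
  let x := u :: s in
  \sum_(0 <= i < size s) gamma x`_i * (S x`_i.+1 - S x`_i).

Definition is_LC T lam gamma S Phi : Prop :=
  [/\ regulated_co T Phi, Phi 0 = 0, no_jumps_co T Phi &
      forall u v, 0 <= u -> u < v -> v < T ->
        LC_sum gamma S u (restr_part (lam m) u v) @[m --> \oo]
          --> Phi v - Phi u].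

Definition LC_defined T lam gamma S : Prop :=
  exists Phi, is_LC T lam gamma S Phi.

(* The integral over [0, u] for 0 <= u < T: on [0, T), Phi as in [is_LC] is
   unique if it exists. *)
Definition LC_int T lam gamma S : R -> R :=
  xget (fun=> 0) [set Phi | is_LC T lam gamma S Phi].

(* The integral over [0, u] for 0 <= u <= T. *)
Definition LC_integral T lam gamma S u : R :=
  if u < T then LC_int T lam gamma S u
  else lim (LC_int T lam gamma S x @[x --> T^'-]).

Definition LC_integrable T lam gamma S : Prop :=
  [/\ {within `[0, T], continuous S}, LC_defined T lam gamma S &
      cvg (LC_int T lam gamma S x @[x --> T^'-])].

Definition trading_strategy T lam (gamma0 gamma1 R0 R1 : R -> R) : Prop :=
  LC_integrable T lam gamma0 R0 /\ LC_integrable T lam gamma1 R1.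

Definition portfolio_value (gamma0 gamma1 R0 R1 : R -> R) t : R :=
  gamma0 t * R0 t + gamma1 t * R1 t.

Definition portfolio_gain T lam (gamma0 gamma1 R0 R1 : R -> R) t : R :=
  LC_integral T lam gamma0 R0 t + LC_integral T lam gamma1 R1 t.

Definition self_financing T lam (gamma0 gamma1 R0 R1 : R -> R) : Prop :=
  forall t, 0 <= t <= T ->
    portfolio_value gamma0 gamma1 R0 R1 t =
    portfolio_value gamma0 gamma1 R0 R1 0 +
    portfolio_gain T lam gamma0 gamma1 R0 R1 t.

End left_cauchy.

Section black_scholes.
Context {R : realType}.
Implicit Types (T K r sigma t x s : R) (P Q : R -> R).

Definition stdN x : R := fine (normal_prob 0 1 `]-oo, x]).

Definition d1 T K r sigma t x : R :=
  (ln (x / K) + (r + sigma ^+ 2 / 2) * (T - t)) / (sigma * Num.sqrt (T - t)).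

Definition d2 T K r sigma t x : R :=
  d1 T K r sigma t x - sigma * Num.sqrt (T - t).

(* Meaningful for 0 <= t <= T and x >= 0. *)
Definition bs_phi T K r sigma t x : R :=
  if x <= 0 then 0
  else if t < T then
    x * stdN (d1 T K r sigma t x)
      - K * expR (- (r * (T - t))) * stdN (d2 T K r sigma t x)
  else Num.max 0 (x - K).

Definition bond r t : R := expR (r * t).

Definition bs_beta T K r sigma P s : R :=
  if s < T then stdN (d1 T K r sigma s (P s)) else 0.

Definition bs_alpha T K r sigma P s : R :=
  (bs_phi T K r sigma s (P s) - P s * bs_beta T K r sigma P s) / bond r s.

End black_scholes.

(* Main.v *)
Require Import Defs.
From HB Require Import structures.
From mathcomp Require Import all_boot all_order all_algebra.
From mathcomp Require Import all_classical all_reals all_analysis.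
From mathcomp Require Import ring lra.

(** The Black-Scholes strategy is shown to be self-financing path by path, from
the quadratic variation of the log-price alone.

A scenario is [P = exp (w - sigma ^ 2 t / 2)], where [w] is the sum of a path
with bracket [sigma ^ 2 t] and a continuous path of bounded [p]-variation.  As
[p < 2], the second path does not contribute to the quadratic variation
([CW_quad0], [quad_sum_add]), so [w] has bracket [sigma ^ 2 t] as well
([Xclass_path]).

Along the path the option value is [V = P N(D1) - k N(D2)], with discounted
strike [k] and [D2 = D1 - dev].  Over a step from [x] to [y] of a partition, the
cash position earns exactly [- N(D2 x) (k y - k x)] ([bs_alpha_bond]), and the
stock position earns [N(D1 x) (P y - P x)].  What the increment of [V] contains
beyond these two gains is computed by a second-order expansion of [N] alone: the
identity [P n(D1) = k n(D2)], with [n] the normal density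
([price_normal_pdf]), cancels the first-order terms, and there remains a
continuous weight times [(w y - w x) ^ 2 - sigma ^ 2 (y - x)], up to errors small
with respect to [(w y - w x) ^ 2 + (y - x)] ([ito_value]).  This replaces the
Ito formula and the Black-Scholes partial differential equation.

Summation over the partitions removes the remainder.  The partitions become
arbitrarily fine ([near_steps]), the sums of the small errors vanish
([lam_sum_small]), and those of the weighted noise vanish because on short
intervals the weight can be frozen ([lam_sum_weighted]).  The gain of the cash
position is a time integral of a bounded function of constant sign, and so has a
limit at [T] ([cvg_left_bounded_derive]).  The gains over [[0, t]] therefore add
up to [V t - V 0] for [t < T] ([bs_gains]), and the identity extends to [T] because
[V] tends to the payoff, also when the scenario ends exactly at the strike
([cvg_value]). *)

Set Implicit Arguments.
Unset Strict Implicit.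
Unset Printing Implicit Defensive.

Import Order.TTheory GRing.Theory Num.Theory.
Import numFieldNormedType.Exports.

Local Open Scope classical_set_scope.
Local Open Scope ring_scope.

(** * Steps of a partition and the filter of fine steps *)
Section Steps.
Context {R : realType}.
Implicit Types (T u v c d : R) (s t : seq R) (lam : nat -> seq R) (e : R * R).

(** Consecutive points as pairs: sums over steps are then ordinary big operators,
and a property of short steps is a property of pairs. *)
Definition steps u s : seq (R * R) := zip (u :: s) s.

Lemma sum_steps (A : R -> R -> R) u s :
  \sum_(0 <= i < size s) A (u :: s)`_i (u :: s)`_i.+1 =
  \sum_(e <- steps u s) A e.1 e.2.
Proof.
elim: s u => [|y s ih] u; first by rewrite /steps /= big_nil big_geq.
by rewrite /steps /= big_nat_recl// big_cons /= ih.
Qed.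

Lemma quad_sumE f u s :
  quad_sum f u s = \sum_(e <- steps u s) (f e.2 - f e.1) ^+ 2.
Proof. exact: (sum_steps (fun x y => (f y - f x) ^+ 2)). Qed.

Lemma pvar_sumE p f u s :
  pvar_sum p f u s = \sum_(e <- steps u s) `|f e.2 - f e.1| `^ p.
Proof. exact: (sum_steps (fun x y => `|f y - f x| `^ p)). Qed.

Lemma LC_sumE gamma S u s :
  LC_sum gamma S u s = \sum_(e <- steps u s) gamma e.1 * (S e.2 - S e.1).
Proof. exact: (sum_steps (fun x y => gamma x * (S y - S x))). Qed.

Lemma steps_cat u s t : steps u (s ++ t) = steps u s ++ steps (last u s) t.
Proof. by elim: s u => //= y s ih u; rewrite /steps /= -ih. Qed.

Lemma sum_steps_telescope (F : R -> R) u s :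
  \sum_(e <- steps u s) (F e.2 - F e.1) = F (last u s) - F u.
Proof.
elim: s u => [|y s ih] u; first by rewrite big_nil subrr.
by rewrite /steps /= big_cons /= ih; ring.
Qed.

Lemma last_restr_part s u v : last u (restr_part s u v) = v.
Proof. by rewrite /restr_part last_rcons. Qed.

Lemma itv_partition_restr s u v : sorted <%R s -> u < v ->
  itv_partition u v (restr_part s u v).
Proof.
move=> ss uv; split; last by rewrite last_restr_part.
rewrite lt_path_sortedE /restr_part all_rcons uv /=; apply/andP; split.
  by rewrite all_filter; apply/allP => x _; apply/implyP => /andP[].
have : all (< v) [seq x <- s | u < x < v].
  by rewrite all_filter; apply/allP => x _; apply/implyP => /andP[].
have := sorted_filter lt_trans (fun x => u < x < v) ss.
elim: [seq _ <- _ | _] => //= a l ih + /andP[av lv].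
rewrite [in X in X -> _]lt_path_sortedE => /andP[al sl].
by rewrite lt_path_sortedE all_rcons av al ih.
Qed.

Lemma restr_part_cat s u c v : sorted <%R s -> c \in s -> u < c -> c < v ->
  restr_part s u v = restr_part s u c ++ restr_part s c v.
Proof.
move=> ss cs uc cv; rewrite /restr_part [in LHS](in_itv_partition ss cs).
rewrite filter_cat filter_rcons uc cv/= rcons_cat -!filter_predI.
congr (rcons _ _ ++ rcons _ _); apply: eq_filter => x /=.
  by case: (ltP x c) => [xc|]; rewrite ?andbF// (lt_trans xc cv) !andbT.
by case: (ltP c x) => [cx|]; rewrite ?andbF// (lt_trans uc cx) !andbT.
Qed.

Lemma in_steps u v s e : itv_partition u v s -> e \in steps u s ->
  [/\ u <= e.1, e.1 < e.2, e.2 <= v &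
      forall c, c \in s -> c <= e.1 \/ e.2 <= c].
Proof.
elim: s u => // y s ih u part.
have [/= /andP[uy ys] _] := part.
have yv := itv_partition_le (itv_partition_cons part).
move: ys; rewrite lt_path_sortedE => /andP[/allP ys _].
rewrite /steps /= inE => /predU1P[->/=|].
  split=> // c; rewrite inE => /predU1P[->|/ys /ltW]; first by right.
  by right.
move=> /(ih _ (itv_partition_cons part))[ye ee ev H]; split=> //.
  exact: le_trans (ltW uy) ye.
by move=> c; rewrite inE => /predU1P[->|/H //]; left.
Qed.

(** The pairs that can be steps of a partition of [[u, v]] of mesh less than
[d]; letting [d] tend to zero they generate the filter [fine_steps], along
which every local estimate below is stated. *)
Definition close_pairs u v d : set (R * R) :=
  [set e | [/\ u <= e.1, e.1 < e.2, e.2 <= v & e.2 - e.1 < d]].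

Definition fine_steps u v : set_system (R * R) :=
  filter_from [set d | 0 < d] (close_pairs u v).

Global Instance fine_steps_filter u v : Filter (fine_steps u v).
Proof.
apply: filter_from_filter; first by exists 1 => /=.
move=> d1 d2 /= d10 d20; exists (Num.min d1 d2) => /=.
  by rewrite lt_min d10.
by move=> e [? ? ?]; rewrite lt_min => /andP[? ?]; split.
Qed.

Lemma near_fine_steps u v : \forall e \near fine_steps u v,
  [/\ u <= e.1, e.1 < e.2 & e.2 <= v].
Proof. by exists 1 => //= e []. Qed.

Lemma fine_stepsS u v a b : u <= a -> b <= v ->
  fine_steps u v `<=` fine_steps a b.
Proof.
move=> ua bv U [d d0 dU]; exists d => // e [ae ee eb ed]; apply: dU; split => //.
  exact: le_trans ua ae.
exact: le_trans eb bv.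
Qed.

End Steps.

(** * Partitions of a nested dense sequence become fine *)
Section Mesh.
Context {R : realType} (T : R) (lam : nat -> seq R).
Hypothesis lamL : Lambda T lam.
Implicit Types (u v c d : R) (e : R * R).

Lemma Lambda_sorted m : sorted <%R (lam m).
Proof. by have [/(_ m)[/path_sorted]] := lamL. Qed.

Lemma Lambda_sub m n : (m <= n)%N -> {subset lam m <= lam n}.
Proof.
have [_ S _] := lamL => /subnK <-; elim: (n - m)%N => // k ih x /ih.
by rewrite addSn; exact: S.
Qed.

(** Nestedness turns density of the union into a point that belongs to all but
finitely many partitions. *)
Lemma Lambda_dense a b : 0 <= a -> a < b -> b <= T ->
  exists c, a < c < b /\ \forall m \near \oo, c \in lam m.
Proof.
move=> a0 ab bT; have [_ _ D] := lamL.
pose x := (a + b) / 2; have xT : `[0, T]%classic x.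
  by rewrite /= in_itv /= /x; lra.
have ab0 : 0 < (b - a) / 2 by lra.
have [c [[m _ /=]]] := D _ xT _ (nbhsx_ballx x _ ab0).
rewrite inE => cm; rewrite /ball /= /x ltr_norml => /andP[xc cx].
have acb : a < c < b by apply/andP; split; lra.
exists c; split=> //; case/predU1P: cm => [c0|cm]; first by lra.
by exists m => // n /= mn; exact: Lambda_sub cm.
Qed.

(** Compactness makes density uniform: around each point of the segment some
partition point is eventually present within half of [d], and finitely many such
points suffice.  Applied to midpoints, this puts a partition point inside every
interval of length [d]. *)
Lemma near_Lambda_dense d : 0 < d ->
  \forall m \near \oo, forall a b, 0 <= a -> b <= T -> d <= b - a ->
    exists2 c, c \in lam m & a < c < b.
Proof.
move=> d0; have d20 : 0 < d / 2 by lra.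
pose Pm m (x : R) := forall h, h = d / 2 -> 0 <= x - h -> x + h <= T ->
  exists2 c, c \in lam m & x - h < c < x + h.
have : \forall m \near \oo, `[0, T] `<=` Pm m.
  have /compact_near_coveringP := @segment_compact R 0 T; apply.
  move=> x; rewrite /= in_itv /= => /andP[x0 xT].
  have [T0|T0] := ltP T d.
    exists (setT, setT) => [|[x' m] _ /= h -> ? ?]; last by exfalso; lra.
    by split; exact: filterT.
  pose a := Num.max 0 (x - d / 4); pose b := Num.min T (x + d / 4).
  have [//||//|c [/andP[ac cb] cm]] := @Lambda_dense a b; rewrite /a /b.
  - by rewrite le_max lexx.
  - by rewrite gt_max !lt_min; apply/andP; split; apply/andP; split; lra.
  - by rewrite ge_min lexx.
  move: ac cb; rewrite /a /b gt_max lt_min => /andP[c0 xc] /andP[cT cx].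
  near=> x' m => h /= -> _ _; exists c; first by near: m.
  have : `|x - x'| < d / 4.
    by near: x'; apply: (@nbhsx_ballx _ R x); lra.
  by rewrite ltr_norml => /andP[? ?]; apply/andP; split; lra.
apply: filterS => m H a b a0 bT ab.
have xT : `[0, T]%classic ((a + b) / 2) by rewrite /= in_itv/=; lra.
have [||c cm cab] := H _ xT (d / 2) erefl; first lra; first lra.
by exists c => //; lra.
Unshelve. all: by end_near. Qed.

(** The bridge from estimates along [fine_steps] to estimates on the partition
sums: a long step would contain a partition point. *)
Lemma near_steps u v (U : set (R * R)) : 0 <= u -> u < v -> v <= T ->
  fine_steps u v U ->
  \forall m \near \oo, forall e, e \in steps u (restr_part (lam m) u v) -> U e.
Proof.
move=> u0 uv vT [d /= d0 dU]; apply: filterS (near_Lambda_dense d0) => m N e es.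
have [ue ee ev H] := in_steps (itv_partition_restr (Lambda_sorted m) uv) es.
apply: dU; split => //; rewrite ltNge; apply/negP => ed.
have e0 := le_trans u0 ue; have eT := le_trans ev vT.
have [c cm /andP[ec ce]] := N _ _ e0 eT ed.
have [||] := H c; last 2 first.
- by rewrite leNgt ec.
- by rewrite leNgt ce.
rewrite /restr_part mem_rcons inE mem_filter cm.
by rewrite (le_lt_trans ue ec) (lt_le_trans ce ev) orbT.
Qed.

End Mesh.

(** * Uniform continuity on a segment *)

(** Only one of the two points is required to lie in the segment, because
continuity is continuity in the whole line at each point of the segment. *)
Lemma segment_unif_continuous (R : realType) (f : R -> R) (u v : R) :
  {in `[u, v], continuous f} -> forall eps : R, 0 < eps ->
  exists2 d, 0 < d &
    forall x y, x \in `[u, v] -> `|x - y| < d -> `|f x - f y| <= eps.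
Proof.
move=> cf eps eps0.
have : \forall d \near 0^'+, `[u, v] `<=`
    [set x | forall y, `|x - y| < d -> `|f x - f y| <= eps].
  have /compact_near_coveringP := @segment_compact R u v; apply => x xuv.
  have eps20 : 0 < eps / 2 by lra.
  have /cvgrPdist_lt /(_ _ eps20) /nbhs_ballP [d /= d0 fd] := cf _ xuv.
  have d20 : 0 < d / 2 by lra.
  near=> x' d' => y /= xy.
  have xx' : `|x - x'| < d / 2 by near: x'; exact: (@nbhsx_ballx _ R x).
  have dd' : d' < d / 2 by near: d'; exact: nbhs_right_lt.
  have fx' : `|f x - f x'| < eps / 2.
    by apply: fd; rewrite /ball /=; apply: lt_trans xx' _; lra.
  have fy : `|f x - f y| < eps / 2.
    apply: fd; rewrite /ball /= -(subrKA x').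
    by apply: (le_lt_trans (ler_normD _ _)); lra.
  rewrite -(subrKA (f x)); apply: (le_trans (ler_normD _ _)).
  by rewrite (distrC (f x')); lra.
move=> H; have [d [d0 Hd]] : exists d, 0 < d /\ `[u, v] `<=`
    [set x | forall y, `|x - y| < d -> `|f x - f y| <= eps].
  near (0 : R)^'+ => d; exists d; split; last by near: d.
  by near: d; exact: nbhs_right_gt.
by exists d => // x y xuv; exact: Hd xuv y.
Unshelve. all: by end_near. Qed.

(** * Sums along the partitions *)
Section PartitionSums.
Context {R : realType} (T : R) (lam : nat -> seq R).
Hypothesis lamL : Lambda T lam.
Implicit Types (u v c d : R) (e : R * R) (A B M : R * R -> R).

Definition lam_sum u v A m : R := \sum_(e <- steps u (restr_part (lam m) u v)) A e.

Lemma lam_sumD u v A B m :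
  lam_sum u v (fun e => A e + B e) m = lam_sum u v A m + lam_sum u v B m.
Proof. exact: big_split. Qed.

Lemma lam_sumZ u v k A m :
  lam_sum u v (fun e => k * A e) m = k * lam_sum u v A m.
Proof. by rewrite /lam_sum mulr_sumr. Qed.

Lemma lam_sum_telescope u v (F : R -> R) m :
  lam_sum u v (fun e => F e.2 - F e.1) m = F v - F u.
Proof. by rewrite /lam_sum sum_steps_telescope last_restr_part. Qed.

(** Splitting at a point of the partition makes the sums exactly additive, with
no correction for a step that straddles the splitting point. *)
Lemma lam_sum_cat u c v A m : c \in lam m -> u < c -> c < v ->
  lam_sum u v A m = lam_sum u c A m + lam_sum c v A m.
Proof.
move=> cm uc cv; rewrite /lam_sum (restr_part_cat (Lambda_sorted lamL m) cm)//.
by rewrite steps_cat big_cat last_restr_part.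
Qed.

Lemma lam_sum_le u v A B : 0 <= u -> u < v -> v <= T ->
  (\forall e \near fine_steps u v, A e <= B e) ->
  \forall m \near \oo, lam_sum u v A m <= lam_sum u v B m.
Proof.
move=> u0 uv vT /(near_steps lamL u0 uv vT); apply: filterS => m AB.
by rewrite /lam_sum big_seq [leRHS]big_seq; apply: ler_sum.
Qed.

Lemma lam_sum_eq u v A B : 0 <= u -> u < v -> v <= T ->
  (\forall e \near fine_steps u v, A e = B e) ->
  \forall m \near \oo, lam_sum u v A m = lam_sum u v B m.
Proof.
move=> u0 uv vT /(near_steps lamL u0 uv vT); apply: filterS => m AB.
by rewrite /lam_sum big_seq [RHS]big_seq; apply: eq_bigr.
Qed.

Lemma lam_sum_norm_le u v A B : 0 <= u -> u < v -> v <= T ->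
  (\forall e \near fine_steps u v, `|A e| <= B e) ->
  \forall m \near \oo, `|lam_sum u v A m| <= lam_sum u v B m.
Proof.
move=> u0 uv vT /(lam_sum_le u0 uv vT); apply: filterS => m.
by apply: le_trans; exact: ler_norm_sum.
Qed.

Lemma lam_sum_small u v A M C : 0 <= u -> u < v -> v <= T ->
  (\forall m \near \oo, lam_sum u v M m <= C) ->
  (forall eps, 0 < eps -> \forall e \near fine_steps u v, `|A e| <= eps * M e) ->
  lam_sum u v A @ \oo --> 0.
Proof.
move=> u0 uv vT MC AM; apply/cvgr0Pnorm_le => eps eps0.
have C1 : 0 < `|C| + 1 by rewrite ltr_wpDl.
have dC : 0 < eps / (`|C| + 1) by rewrite divr_gt0.
near=> m.
have : `|lam_sum u v A m| <= lam_sum u v (fun e => eps / (`|C| + 1) * M e) m.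
  by near: m; apply: lam_sum_norm_le => //; exact: AM.
move/le_trans; apply; rewrite lam_sumZ.
rewrite mulrAC ler_pdivrMr// ler_pM2l//.
have : lam_sum u v M m <= C by near: m.
by move/le_trans; apply; rewrite (le_trans (ler_norm _))// lerDl.
Unshelve. all: by end_near. Qed.

(** The freezing argument: on an interval on which [f] oscillates by at most
[eps], replacing [f] by its value at the right endpoint costs at most [eps]
times the sum of [M].  Subdividing at points of the partitions themselves makes
the sums exactly additive for all large [m]. *)
Lemma lam_sum_weighted u v C (f : R -> R) B M : 0 <= u -> u < v -> v <= T ->
  {in `[u, v], continuous f} ->
  (\forall e \near fine_steps u v, `|B e| <= M e) ->
  (forall a b, u <= a -> a < b -> b <= v -> lam_sum a b B @ \oo --> 0) ->
  (forall a b, u <= a -> a < b -> b <= v ->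
     lam_sum a b M @ \oo --> C * (b - a)) ->
  lam_sum u v (fun e => f e.2 * B e) @ \oo --> 0.
Proof.
move=> u0 uv vT cf BM B0 MC.
have freeze eps : 0 < eps -> forall a b, u <= a -> a < b -> b <= v ->
    forall eta, 0 < eta -> \forall m \near \oo,
      `|lam_sum a b (fun e => f e.2 * B e) m| <= eps * C * (b - a) + eta.
  move=> eps0; have [d d0 fd] := segment_unif_continuous cf eps0.
  suff main n : forall a b, u <= a -> a < b -> b <= v -> b - a < n.+1%:R * d ->
    forall eta, 0 < eta -> \forall m \near \oo,
      `|lam_sum a b (fun e => f e.2 * B e) m| <= eps * C * (b - a) + eta.
    move=> a b ua ab bv; apply: (main (Num.truncn ((b - a) / d))) => //.
    by rewrite -ltr_pdivrMr//; apply: truncnS_gt.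
  elim: n => [a b ua ab bv ba eta eta0|n ih a b ua ab bv ba eta eta0].
    have a0 := le_trans u0 ua; have bT := le_trans bv vT.
    have fM : \forall e \near fine_steps a b,
        `|f e.2 * B e - f b * B e| <= eps * M e.
      have BMab := fine_stepsS ua bv BM.
      apply: filterS (filterI BMab (near_fine_steps a b)) => e [BMe [ae ee eb]].
      rewrite -mulrBl normrM; apply: ler_pM => //.
      rewrite distrC; apply: fd; first by rewrite in_itv /=; lra.
      by rewrite ger0_norm; lra.
    have eta30 : 0 < eta / 2 by lra.
    have cB : (fun m => f b * lam_sum a b B m) @ \oo --> f b * 0.
      by apply: cvgMr; exact: B0.
    have cM : (fun m => eps * lam_sum a b M m) @ \oo --> eps * (C * (b - a)).
      by apply: cvgMr; exact: MC.
    near=> m.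
    have H1 : `|lam_sum a b (fun e => f e.2 * B e - f b * B e) m| <=
        lam_sum a b (fun e => eps * M e) m.
      by near: m; apply: lam_sum_norm_le.
    have H2 : `|f b * 0 - f b * lam_sum a b B m| < eta / 2.
      by near: m; move/cvgrPdist_lt : cB; apply.
    have H3 : `|eps * (C * (b - a)) - eps * lam_sum a b M m| < eta / 2.
      by near: m; move/cvgrPdist_lt : cM; apply.
    have -> : lam_sum a b (fun e => f e.2 * B e) m =
        lam_sum a b (fun e => f e.2 * B e - f b * B e) m + f b * lam_sum a b B m.
      rewrite -lam_sumZ -lam_sumD; apply: eq_bigr => e _; ring.
    apply: (le_trans (ler_normD _ _)).
    rewrite lam_sumZ in H1; rewrite mulr0 sub0r normrN in H2.
    by move: H3; rewrite ltr_norml => /andP[H3 _]; lra.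
  have [ba'|ba'] := ltP (b - a) (n.+1%:R * d); first exact: ih.
  have nd : n.+2%:R * d = n.+1%:R * d + d by rewrite -[in LHS]natr1 mulrDl mul1r.
  have nd0 : d <= n.+1%:R * d by rewrite ler_peMl ?ler1n// ltW.
  (* Both pieces are within the reach of the induction hypothesis: the one on
     the right is shorter than [d], the one on the left than [n.+1%:R * d]. *)
  have [|||c [/andP[cl cr] cm]] :=
    @Lambda_dense _ _ _ lamL (b - d) (a + n.+1%:R * d); [lra|lra|lra|].
  have eta20 : 0 < eta / 2 by lra.
  have cb : c < b by lra.
  have H1 := ih a c ua _ (le_trans (ltW cb) bv) _ _ eta20.
  have H2 := ih c b _ cb bv _ _ eta20.
  near=> m.
  have H1m : `|lam_sum a c (fun e => f e.2 * B e) m| <=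
      eps * C * (c - a) + eta / 2 by near: m; apply: H1; lra.
  have H2m : `|lam_sum c b (fun e => f e.2 * B e) m| <=
      eps * C * (b - c) + eta / 2 by near: m; apply: H2; lra.
  rewrite (@lam_sum_cat a c b) //; [|by near: m|lra].
  apply: (le_trans (ler_normD _ _)); apply: (le_trans (lerD H1m H2m)).
  by rewrite le_eqVlt; apply/orP; left; apply/eqP; field.
apply/cvgr0Pnorm_le => eps eps0.
have C0 : 0 < `|C| * (v - u) + 1 by rewrite ltr_wpDl// mulr_ge0//; lra.
have H0 : 0 < eps / 2 / (`|C| * (v - u) + 1) by rewrite !divr_gt0.
apply: filterS (freeze _ H0 u v (lexx _) uv (lexx _) (eps / 2) _); last lra.
move=> m /le_trans; apply.
set k := _ / _ in H0 *; have : k * (`|C| * (v - u) + 1) = eps / 2.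
  by rewrite /k divfK// gt_eqF.
have : k * C * (v - u) <= k * (`|C| * (v - u)).
  by rewrite mulrA ler_wpM2r ?ler_wpM2l ?ler_norm ?ltW//; lra.
by lra.
Unshelve. all: by end_near. Qed.

End PartitionSums.

(** * Error terms along a filter *)
Section Asymptotics.
Context {R : realType} {I : Type} (F : set_system I) {FF : Filter F}.
Implicit Types A B M N : I -> R.

(** Big-O and little-o along a filter, phrased with explicit bounds: the scale
[M] will be [1], the time increment, or the sum of the time increment and the
squared increment of the path.  Positivity of the constant in [dominated] forces
[M] to be eventually nonnegative. *)
Definition dominated M A :=
  exists2 C : R, 0 < C & \forall e \near F, `|A e| <= C * M e.

Definition small M A :=
  forall eps : R, 0 < eps -> \forall e \near F, `|A e| <= eps * M e.

Local Notation bounded := (dominated (fun=> 1)).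
Local Notation vanishing := (small (fun=> 1)).

Lemma small_dominated M A : small M A -> dominated M A.
Proof. by move=> /(_ 1 ltr01); exists 1. Qed.

Lemma dominatedD M A B :
  dominated M A -> dominated M B -> dominated M (fun e => A e + B e).
Proof.
move=> [C C0 CA] [D D0 DB]; exists (C + D); first exact: addr_gt0.
near=> e; rewrite mulrDl (le_trans (ler_normD _ _))// lerD//.
  by near: e.
by near: e.
Unshelve. all: by end_near. Qed.

Lemma dominatedN M A : dominated M A -> dominated M (fun e => - A e).
Proof.
by move=> [C C0 CA]; exists C => //; apply: filterS CA => e; rewrite normrN.
Qed.

Lemma dominatedB M A B :
  dominated M A -> dominated M B -> dominated M (fun e => A e - B e).
Proof. by move=> dA dB; apply: dominatedD => //; exact: dominatedN. Qed.

Lemma smallD M A B :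
  small M A -> small M B -> small M (fun e => A e + B e).
Proof.
move=> nA nB eps eps0; have eps20 : 0 < eps / 2 by rewrite divr_gt0.
near=> e; have -> : eps * M e = eps / 2 * M e + eps / 2 * M e by field.
rewrite (le_trans (ler_normD _ _))// lerD//; first by near: e; exact: nA.
by near: e; exact: nB.
Unshelve. all: by end_near. Qed.

Lemma smallN M A : small M A -> small M (fun e => - A e).
Proof. by move=> nA eps /nA; apply: filterS => e; rewrite normrN. Qed.

Lemma smallB M A B :
  small M A -> small M B -> small M (fun e => A e - B e).
Proof. by move=> nA nB; apply: smallD => //; exact: smallN. Qed.

Lemma dominatedM M A B :
  bounded A -> dominated M B -> dominated M (fun e => A e * B e).
Proof.
move=> [C C0 CA] [D D0 DB]; exists (C * D); first exact: mulr_gt0.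
near=> e; rewrite normrM -mulrA; apply: ler_pM => //.
  by rewrite -[leRHS]mulr1; near: e.
by near: e.
Unshelve. all: by end_near. Qed.

Lemma smallM M A B :
  vanishing A -> dominated M B -> small M (fun e => A e * B e).
Proof.
move=> nA [D D0 DB] eps eps0.
have d0 : 0 < eps / D by rewrite divr_gt0.
near=> e.
have -> : eps * M e = eps / D * (D * M e) by rewrite mulrA divfK// gt_eqF.
rewrite normrM; apply: ler_pM => //; last by near: e.
by rewrite -[leRHS]mulr1; near: e; exact: nA.
Unshelve. all: by end_near. Qed.

Lemma dominated_smallM M A B :
  bounded A -> small M B -> small M (fun e => A e * B e).
Proof.
move=> [D D0 DA] nB eps eps0.
have d0 : 0 < eps / D by rewrite divr_gt0.
near=> e.
have -> : eps * M e = D * (eps / D * M e).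
  by rewrite mulrA (mulrC D) divfK// gt_eqF.
rewrite normrM; apply: ler_pM => //; last by near: e; exact: nB.
by rewrite -[leRHS]mulr1; near: e.
Unshelve. all: by end_near. Qed.

Lemma small_trans M N A : dominated N M -> small M A -> small N A.
Proof.
move=> [D D0 DM] nA eps eps0; have d0 : 0 < eps / D by rewrite divr_gt0.
near=> e; have -> : eps * N e = eps / D * (D * N e).
  by rewrite mulrA divfK// gt_eqF.
have : `|A e| <= eps / D * M e by near: e; exact: nA.
move/le_trans; apply; rewrite ler_pM2l//; apply: le_trans (ler_norm _) _.
by near: e.
Unshelve. all: by end_near. Qed.

Lemma bounded_cst (c : R) : bounded (fun=> c).
Proof.
exists (`|c| + 1); first by rewrite ltr_wpDl.
by apply: nearW => e; rewrite mulr1 lerDl.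
Qed.

Lemma dominated_vanishing M A : vanishing M -> dominated M A -> vanishing A.
Proof.
move=> nM [D D0 DA] eps eps0; have d0 : 0 < eps / D by rewrite divr_gt0.
near=> e; have : `|A e| <= D * M e by near: e.
move/le_trans; apply; rewrite mulr1 mulrC -ler_pdivlMr//.
rewrite (le_trans (ler_norm _))// -[leRHS]mulr1.
by near: e; exact: nM.
Unshelve. all: by end_near. Qed.

Lemma dominated_le M A : (\forall e \near F, `|A e| <= M e) -> dominated M A.
Proof. by exists 1 => //; near do rewrite mul1r. Unshelve. all: by end_near. Qed.

Lemma dominated_near M A B :
  (\forall e \near F, A e = B e) -> dominated M A -> dominated M B.
Proof.
move=> AB [C C0 CA]; exists C => //; near=> e.
by rewrite -(near AB e)//; near: e.
Unshelve. all: by end_near. Qed.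

Lemma small_near M A B :
  (\forall e \near F, A e = B e) -> small M A -> small M B.
Proof.
move=> AB nA eps eps0; near=> e.
by rewrite -(near AB e)//; near: e; exact: nA.
Unshelve. all: by end_near. Qed.

End Asymptotics.

Notation bounded F := (dominated F (fun=> 1)).
Notation vanishing F := (small F (fun=> 1)).

(** * Uniform Taylor expansions *)

Lemma increment_le_itv (R : realType) (F f : R -> R) (a b C : R) : a <= b ->
  (forall z, z \in `[a, b] -> is_derive z 1 F (f z) /\ `|f z| <= C) ->
  `|F b - F a| <= C * (b - a).
Proof.
move=> ab H; have [||z zab ->] := @MVT_segment _ F f a b ab.
- by move=> z zab; apply: (H z _).1; apply: subset_itv_oo_cc zab.
- apply: continuous_in_subspaceT => z; rewrite inE => /H[dF _].
  exact/differentiable_continuous/derivable1_diffP.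
- rewrite normrM (@ger0_norm _ (b - a)) ?subr_ge0//.
  by rewrite ler_wpM2r ?subr_ge0//; exact: (H z zab).2.
Qed.

(** The hypothesis is on a ball around [y], so that the two points may come in
either order, as increments of a path do. *)
Lemma increment_le (R : realType) (F f : R -> R) (x y C : R) :
  (forall z, `|z - y| <= `|x - y| -> is_derive z 1 F (f z) /\ `|f z| <= C) ->
  `|F y - F x| <= C * `|y - x|.
Proof.
move=> Hf.
have [xy|yx] := leP x y.
  rewrite [X in _ * X]ger0_norm ?subr_ge0//; apply: (increment_le_itv xy) => z.
  rewrite in_itv /= => /andP[xz zy]; apply: Hf.
  by rewrite !ler0_norm; lra.
rewrite distrC (distrC y) [X in _ * X]ger0_norm ?subr_ge0 ?(ltW yx)//.
apply: (increment_le_itv (ltW yx)) => z.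
rewrite in_itv /= => /andP[xz zy]; apply: Hf.
by rewrite !ger0_norm; lra.
Qed.

(** Two nested applications of the mean value inequality to the remainders of
[f] and of [F] turn the uniform continuity of [f1] into the stated bound. *)
Lemma taylor2_uniform (R : realType) (F f f1 : R -> R) (a b : R) :
  (forall x : R, is_derive x 1 F (f x)) ->
  (forall x : R, is_derive x 1 f (f1 x)) -> continuous f1 ->
  forall eps : R, 0 < eps -> exists2 d, 0 < d &
    forall x y, y \in `[a, b] -> `|y - x| < d ->
    `|F y - F x - f y * (y - x) + 2^-1 * f1 y * (y - x) ^+ 2|
      <= eps * (y - x) ^+ 2.
Proof.
move=> dF df cf1 eps eps0.
have [|d d0 f1d] := @segment_unif_continuous _ f1 a b _ _ eps0.
  by move=> x _; exact: cf1.
exists d => // x y yab yx.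
have first_order z : `|z - y| <= `|x - y| ->
    `|f y - f z - f1 y * (y - z)| <= eps * `|y - z|.
  move=> zx; pose g t := f t - f1 y * t.
  have -> : f y - f z - f1 y * (y - z) = g y - g z by rewrite /g; ring.
  apply: (@increment_le _ g (fun t => f1 t - f1 y)) => t tz; split.
    by apply: is_derive_eq; rewrite [_%:A]mulr1.
  rewrite distrC; apply: f1d => //; rewrite distrC; apply: le_lt_trans tz _.
  by apply: le_lt_trans zx _; rewrite distrC.
pose G t := F t - f y * t - 2^-1 * f1 y * (t - y) ^+ 2.
have -> : F y - F x - f y * (y - x) + 2^-1 * f1 y * (y - x) ^+ 2 = G y - G x.
  by rewrite /G; field.
rewrite -(@ger0_norm _ ((y - x) ^+ 2)) ?sqr_ge0// normrX expr2 mulrA.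
apply: (@increment_le _ G (fun t => f t - f y - f1 y * (t - y))) => t tz; split.
  by apply: is_derive_eq; rewrite /GRing.scale /=; field.
have -> : f t - f y - f1 y * (t - y) = - (f y - f t - f1 y * (y - t)) by ring.
rewrite normrN; apply: (le_trans (first_order t tz)).
by rewrite ler_pM2l// -(distrC x) -(distrC t).
Qed.

Section FineAsymptotics.
Context {R : realType} (u v : R) (f : R -> R).
Hypothesis cf : {in `[u, v], continuous f}.
Local Notation F := (fine_steps u v).

Lemma bounded_right : bounded F (fun e => f e.2).
Proof.
have [uv|vu] := leP u v; last first.
  exists 1 => //; apply: filterS (near_fine_steps u v) => e [ue ee ev].
  by have := lt_trans (le_lt_trans ue ee) (le_lt_trans ev vu); rewrite ltxx.
have [|c _ fc] := @EVT_max _ (fun x => `|f x|) u v uv.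
  apply: continuous_in_subspaceT => x xuv; apply: continuous_comp.
    by apply: cf; rewrite inE in xuv.
  exact: norm_continuous.
exists (`|f c| + 1); first by rewrite ltr_wpDl.
apply: filterS (near_fine_steps u v) => e [ue ee ev].
rewrite mulr1 ler_wpDr//; apply: fc.
by rewrite in_itv /= ev (le_trans ue (ltW ee)).
Qed.

Lemma vanishing_increment : vanishing F (fun e => f e.2 - f e.1).
Proof.
move=> eps /(segment_unif_continuous cf)[d d0 fd]; exists d => // e [ue ee ev ed].
rewrite mulr1; apply: fd; first by rewrite in_itv /= ev (le_trans ue (ltW ee)).
by rewrite ger0_norm ?subr_ge0 ?ltW.
Qed.

Lemma bounded_left : bounded F (fun e => f e.1).
Proof.
have bB : bounded F (fun e => f e.2 - (f e.2 - f e.1)).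
  exact: dominatedB bounded_right (small_dominated vanishing_increment).
by apply: (dominated_near _ bB); apply: nearW => e; rewrite opprB addrC subrK.
Qed.

Lemma small_first_order (f' : R -> R) :
  (forall x, x \in `[u, v] -> is_derive x 1 f (f' x)) ->
  {in `[u, v], continuous f'} ->
  small F (fun e => e.2 - e.1)
    (fun e => f e.2 - f e.1 - f' e.1 * (e.2 - e.1)).
Proof.
move=> df cf' eps /(segment_unif_continuous cf')[d d0 fd].
exists d => // e [ue ee ev ed].
pose G z := f z - f' e.1 * z.
have -> : f e.2 - f e.1 - f' e.1 * (e.2 - e.1) = G e.2 - G e.1 by rewrite /G; ring.
apply: (@increment_le_itv _ G (fun z => f' z - f' e.1)) => [|z]; first exact: ltW.
rewrite in_itv /= => /andP[ez ze].
have zuv : z \in `[u, v] by rewrite in_itv /=; lra.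
split; last by apply: fd => //; rewrite ger0_norm; lra.
by have := df z zuv => dfz; apply: is_derive_eq; rewrite [_%:A]mulr1.
Qed.

Lemma small_taylor2 (G g g1 : R -> R) :
  (forall x : R, is_derive x 1 G (g x)) ->
  (forall x : R, is_derive x 1 g (g1 x)) -> continuous g1 ->
  small F (fun e => (f e.2 - f e.1) ^+ 2)
    (fun e => G (f e.2) - G (f e.1) - g (f e.2) * (f e.2 - f e.1) +
              2^-1 * g1 (f e.2) * (f e.2 - f e.1) ^+ 2).
Proof.
move=> dG dg cg1 eps eps0; have [C C0 fC] := bounded_right.
have [d d0 Gd] := taylor2_uniform (- C) C dG dg cg1 eps0.
have d20 : 0 < d / 2 by lra.
have := vanishing_increment d20 => fd.
near=> e; apply: Gd.
  by rewrite in_itv /= -ler_norml -[leRHS]mulr1; near: e.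
by apply: le_lt_trans (near fd e _) _ => //; lra.
Unshelve. all: by end_near. Qed.

End FineAsymptotics.

(** * The standard normal distribution function *)
Section StandardNormal.
Context {R : realType}.
Implicit Types x y : R.
Local Notation n01 := (normal_pdf (0 : R) 1).
Local Notation peak := (normal_peak (1 : R)).

Lemma normal_pdf01E x : n01 x = peak * expR (- (x ^+ 2 / 2)).
Proof.
rewrite normal_pdfE ?oner_eq0// /normal_fun subr0 expr1n.
by congr (_ * expR _); rewrite mulNr.
Qed.

Lemma is_derive_normal_pdf01 x : is_derive x 1 n01 (- x * n01 x).
Proof.
rewrite (_ : n01 = fun y => peak * expR (- (y ^+ 2 / 2))); last first.
  by apply/funext => y; rewrite normal_pdf01E.
by apply: is_derive_eq; rewrite /GRing.scale /=; field.
Qed.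

(** The fundamental theorem of calculus with lower endpoint minus infinity. *)
Lemma is_derive_stdN x : is_derive x 1 stdN (n01 x).
Proof.
have [||||dN N'] := @continuous_FTC1 R n01 -oo%O x (x + 1).
- by rewrite ltrDl.
- apply: integrableS (integrable_normal_pdf 0 1) => //.
- exact: ltNyr.
- by apply: continuous_normal_pdf; rewrite oner_eq0.
by apply: DeriveDef; [exact: dN|rewrite -N' derive1E].
Qed.

Lemma continuous_stdN : continuous (@stdN R).
Proof.
move=> x; have [+ _] := is_derive_stdN x.
by move=> /derivable1_diffP/differentiable_continuous.
Qed.

Lemma stdN_lipschitz x y : `|stdN y - stdN x| <= peak * `|y - x|.
Proof.
apply: (@increment_le _ _ n01) => z _; split; first exact: is_derive_stdN.
by rewrite ger0_norm ?normal_pdf_ge0// normal_pdf_ub// oner_eq0.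
Qed.

Let idTR : measurableTypeR R -> R := idfun.

#[local] HB.instance Definition _ :=
  @isMeasurableFun.Build _ _ _ _ idTR (@measurable_id _ _ setT).

Let X : {RV (normal_prob (0 : R) 1) >-> R} := idTR.

(** Seeing [stdN] as the distribution function of the identity random variable
gives its bounds and its limits at infinity. *)
Lemma stdNE x : (stdN x)%:E = cdf X x.
Proof. by rewrite /stdN fineK ?fin_num_measure. Qed.

Lemma stdN_ge0 x : 0 <= stdN x.
Proof. by rewrite -lee_fin stdNE cdf_ge0. Qed.

Lemma stdN_le1 x : stdN x <= 1.
Proof. by rewrite -lee_fin stdNE cdf_le1. Qed.

Lemma cvg_stdNy : stdN x @[x --> +oo] --> (1 : R).
Proof. exact: (fine_cvg (cvg_cdfy1 X)). Qed.

Lemma cvg_stdNNy : stdN x @[x --> -oo] --> (0 : R).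
Proof. exact: (fine_cvg (cvg_cdfNy0 X)). Qed.

End StandardNormal.

(** * The Black-Scholes quantities along a path *)
Section BlackScholesPath.
Context {R : realType} (T sigma K r : R) (w : R -> R).
Hypotheses (sigma0 : 0 < sigma) (K0 : 0 < K).
Hypothesis cw : continuous w.
Implicit Types t u v : R.
Local Notation n01 := (normal_pdf (0 : R) 1).

(** The state of the model along a path [w]: [dev] is the standard deviation of
the remaining log-return, [strike] the discounted strike, and [D1] the closed
form of [d1] at the current price, with the logarithm already undone. *)
Definition price t : R := expR (w t - 2^-1 * (sigma ^+ 2 * t)).
Definition dev t : R := sigma * Num.sqrt (T - t).
Definition strike t : R := K * expR (- (r * (T - t))).
Definition D1 t : R :=
  (w t - 2^-1 * (sigma ^+ 2 * t) - ln K + (r + sigma ^+ 2 / 2) * (T - t)) / dev t.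
Definition D2 t : R := D1 t - dev t.
Definition value t : R := price t * stdN (D1 t) - strike t * stdN (D2 t).

Lemma price_gt0 t : 0 < price t. Proof. exact: expR_gt0. Qed.

Lemma strike_gt0 t : 0 < strike t.
Proof. by rewrite mulr_gt0 ?expR_gt0. Qed.

Lemma d1_price t : d1 T K r sigma t (price t) = D1 t.
Proof.
by rewrite /d1 /D1 ln_div ?posrE ?price_gt0// expRK.
Qed.

Lemma d2_price t : d2 T K r sigma t (price t) = D2 t.
Proof. by rewrite /d2 d1_price. Qed.

Lemma dev_gt0 t : t < T -> 0 < dev t.
Proof. by move=> tT; rewrite mulr_gt0// sqrtr_gt0 subr_gt0. Qed.

Lemma dev_sqr t : t <= T -> dev t ^+ 2 = sigma ^+ 2 * (T - t).
Proof. by move=> tT; rewrite exprMn sqr_sqrtr// subr_ge0. Qed.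

Lemma D1_dev t : t < T -> D1 t * dev t =
  w t - 2^-1 * (sigma ^+ 2 * t) - ln K + (r + sigma ^+ 2 / 2) * (T - t).
Proof. by move=> tT; rewrite divfK// gt_eqF ?dev_gt0. Qed.

(** The optimality behind the hedge: [D1] is the critical point of
[d |-> price * N(d) - strike * N(d - dev)].  It makes the first-order part of
the variation of [D1] cancel out of the variation of the option value. *)
Lemma price_normal_pdf t : t < T ->
  price t * n01 (D1 t) = strike t * n01 (D2 t).
Proof.
move=> tT; rewrite !normal_pdf01E /price /strike.
rewrite !(mulrCA _ (normal_peak 1)); congr (_ * _).
rewrite -mulrA -expRD -{1}(lnK K0) -!expRD; congr expR.
have := D1_dev tT; have := dev_sqr (ltW tT); rewrite /D2.
move: (D1 t) (dev t) => a b sb ab.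
have -> : w t = a * b + 2^-1 * (sigma ^+ 2 * t) + ln K
    - (r + sigma ^+ 2 / 2) * (T - t).
  by rewrite ab; ring.
apply/eqP; rewrite -subr_eq0; apply/eqP.
transitivity ((b ^+ 2 - sigma ^+ 2 * (T - t)) / 2); first by field.
by rewrite sb subrr mul0r.
Qed.

Lemma continuous_price : continuous price.
Proof.
move=> t; apply: continuous_comp; last exact: continuous_expR.
apply: cvgB; [exact: cw|apply: cvgMr].
by apply: cvgMr.
Qed.

Lemma continuous_strike : continuous strike.
Proof.
move=> t; apply: cvgMr; apply: continuous_comp; last exact: continuous_expR.
by apply: cvgN; apply: cvgMr; apply: cvgB => //; exact: cvg_cst.
Qed.

Lemma continuous_dev : continuous dev.
Proof.
move=> t; apply: cvgMr; apply: continuous_comp; last exact: sqrt_continuous.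
by apply: cvgB => //; exact: cvg_cst.
Qed.

Lemma continuous_D1 t : t < T -> {for t, continuous D1}.
Proof.
move=> tT; apply: cvgM; last first.
  by apply: cvgV; [rewrite gt_eqF ?dev_gt0|exact: continuous_dev].
apply: cvgD.
  apply: cvgB; last exact: cvg_cst.
  by apply: cvgB; [exact: cw|apply: cvgMr; exact: cvgMr].
by apply: cvgMr; apply: cvgB => //; exact: cvg_cst.
Qed.

Lemma continuous_D2 t : t < T -> {for t, continuous D2}.
Proof. by move=> tT; apply: cvgB; [exact: continuous_D1|exact: continuous_dev]. Qed.

Lemma continuous_ND1 t : t < T -> {for t, continuous (fun t => stdN (D1 t))}.
Proof.
move=> tT; apply: continuous_comp; first exact: continuous_D1.
exact: continuous_stdN.
Qed.

Lemma continuous_ND2 t : t < T -> {for t, continuous (fun t => stdN (D2 t))}.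
Proof.
move=> tT; apply: continuous_comp; first exact: continuous_D2.
exact: continuous_stdN.
Qed.

Lemma continuous_value t : t < T -> {for t, continuous value}.
Proof.
move=> tT; apply: cvgB; apply: cvgM.
- exact: continuous_price.
- exact: continuous_ND1.
- exact: continuous_strike.
- exact: continuous_ND2.
Qed.

End BlackScholesPath.

(** * Local expansion of the option value *)
Section BlackScholesIto.
Context {R : realType} (T sigma K r : R) (w : R -> R).
Hypotheses (sigma0 : 0 < sigma) (K0 : 0 < K).
Hypothesis cw : continuous w.
Context (u v : R).
Hypothesis vT : v < T.
Local Notation n01 := (normal_pdf (0 : R) 1).
Local Notation F := (fine_steps u v).
Local Notation price := (price sigma w).
Local Notation dev := (dev T sigma).
Local Notation strike := (strike T K r).
Local Notation D1 := (D1 T sigma K r w).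
Local Notation D2 := (D2 T sigma K r w).
Local Notation value := (value T sigma K r w).

Let dt (e : R * R) := e.2 - e.1.
Let dw (e : R * R) := w e.2 - w e.1.
Let dD (e : R * R) := D1 e.2 - D1 e.1.
Let dE (e : R * R) := D2 e.2 - D2 e.1.
Let ds (e : R * R) := dev e.2 - dev e.1.
(* The part of [dev y * (D1 y - D1 x)] that does not come from [w]: a linear
   drift, and a correction for the variation of [dev]. *)
Let Z (e : R * R) := - (r + sigma ^+ 2) * dt e - D1 e.1 * ds e.

(** The common scale of all the error terms: its partition sums stay bounded,
so that the sums of anything small with respect to it vanish. *)
Definition qd (e : R * R) := (w e.2 - w e.1) ^+ 2 + (e.2 - e.1).

Let inT x : x \in `[u, v] -> x < T.
Proof. by rewrite in_itv /= => /andP[_ /le_lt_trans]; exact. Qed.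

Let cD1 : {in `[u, v], continuous D1}.
Proof. by move=> x /inT; exact: continuous_D1. Qed.

Let cD2 : {in `[u, v], continuous D2}.
Proof. by move=> x /inT; exact: continuous_D2. Qed.

Let cdev : {in `[u, v], continuous dev}.
Proof. by move=> x _; exact: continuous_dev. Qed.

Let cdevV : {in `[u, v], continuous (fun x => (dev x)^-1)}.
Proof.
move=> x /inT xT; apply: cvgV; last exact: continuous_dev.
by rewrite gt_eqF ?dev_gt0.
Qed.

Let cn (X : R -> R) : {in `[u, v], continuous X} ->
  {in `[u, v], continuous (n01 \o X)}.
Proof.
move=> cX x /cX cXx; apply: continuous_comp => //.
by apply: continuous_normal_pdf; rewrite oner_eq0.
Qed.

(** The Gamma of the option, [n(D1) / (price * dev)], times [price ^ 2]. *)
Definition curvature x := price x * n01 (D1 x) / dev x.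

Lemma continuous_curvature : {in `[u, v], continuous curvature}.
Proof.
move=> x xuv; apply: cvgM; last exact: cdevV.
by apply: cvgM; [exact: continuous_price|exact: cn].
Qed.

Lemma dt_qd : dominated F qd dt.
Proof.
apply: dominated_le; apply: filterS (near_fine_steps u v) => e [_ ee _].
by rewrite /qd ger0_norm ?subr_ge0 ?(ltW ee)// lerDr sqr_ge0.
Qed.

Let dw2_qd : dominated F qd (fun e => dw e ^+ 2).
Proof.
apply: dominated_le; apply: filterS (near_fine_steps u v) => e [_ ee _].
by rewrite /qd ger0_norm ?sqr_ge0// lerDl subr_ge0 ltW.
Qed.

Let vdw : vanishing F dw.
Proof. by apply: vanishing_increment => x _; exact: cw. Qed.

Let vdt : vanishing F dt.
Proof. by apply: (@vanishing_increment _ u v id) => x _; exact: cvg_id. Qed.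

Let vds : vanishing F ds.
Proof. exact: vanishing_increment. Qed.

Let vdD : vanishing F dD.
Proof. exact: vanishing_increment. Qed.

Let vdE : vanishing F dE.
Proof. exact: vanishing_increment. Qed.

Let nearT : \forall e \near F, [/\ e.1 < e.2, e.1 < T & e.2 < T].
Proof.
apply: filterS (near_fine_steps u v) => e [_ ee ev]; split => //.
  exact: lt_trans ee (le_lt_trans ev vT).
exact: le_lt_trans ev vT.
Qed.

(* [dev ^ 2] is affine in time, so its increment is known exactly. *)
Let dev_step x y : x < T -> y < T ->
  (dev y - dev x) * (dev y + dev x) = - sigma ^+ 2 * (y - x).
Proof.
move=> xT yT; rewrite -subr_sqr !dev_sqr ?ltW//; ring.
Qed.

Let ds_dt : dominated F dt ds.
Proof.
have [C C0 CP] := bounded_right cdevV.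
exists (sigma ^+ 2 * C); first by rewrite mulr_gt0// exprn_gt0.
near=> e; have [ee e1 e2] : [/\ e.1 < e.2, e.1 < T & e.2 < T] by near: e.
have s1 := dev_gt0 sigma0 e1; have s2 := dev_gt0 sigma0 e2.
have sC : 1 <= C * dev e.2.
  rewrite -ler_pdivrMr// div1r (le_trans (ler_norm _))// -[leRHS]mulr1.
  by near: e.
have := dev_step e1 e2; rewrite -/(ds e) => dsE.
have dt0 : 0 < dt e by rewrite subr_gt0.
rewrite -(ler_pM2r (addr_gt0 s2 s1)) -[X in `|_| * X <= _]gtr0_norm ?addr_gt0//.
rewrite -normrM dsE mulNr normrN gtr0_norm ?mulr_gt0 ?exprn_gt0//.
have : sigma ^+ 2 * dt e * 1 <= sigma ^+ 2 * dt e * (C * (dev e.2 + dev e.1)).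
  rewrite ler_pM2l ?mulr_gt0 ?exprn_gt0// mulrDr.
  by rewrite (le_trans sC)// lerDl mulr_ge0 ?ltW.
rewrite mulr1 /dt; move/le_trans; apply.
by rewrite le_eqVlt; apply/orP; left; apply/eqP; ring.
Unshelve. all: by end_near. Qed.

Let Z_dt : dominated F dt Z.
Proof.
apply: dominatedB; apply: dominatedM => //.
- exact: bounded_cst.
- apply: dominated_le; apply: filterS (near_fine_steps u v) => e [_ ee _].
  by rewrite ger0_norm // subr_ge0 ltW.
- exact: bounded_left.
Qed.

Let vZ : vanishing F Z.
Proof. exact: dominated_vanishing vdt Z_dt. Qed.

Let dDE : \forall e \near F, dev e.2 * dD e = dw e + Z e.
Proof.
near=> e; have [ee e1 e2] : [/\ e.1 < e.2, e.1 < T & e.2 < T] by near: e.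
have := D1_dev K r w sigma0 e1; have := D1_dev K r w sigma0 e2.
rewrite /dD /dw /Z /dt /ds => H2 H1.
have -> : dev e.2 * (D1 e.2 - D1 e.1) =
  D1 e.2 * dev e.2 - D1 e.1 * dev e.1 - D1 e.1 * (dev e.2 - dev e.1) by ring.
by rewrite H1 H2; field.
Unshelve. all: by end_near. Qed.

Let small_cross :
  small F qd (fun e => 2 * (dw e * Z e) + (Z e * Z e + ds e * ds e)).
Proof.
apply: (small_trans dt_qd); apply: smallD; last first.
  by apply: smallD; apply: smallM.
apply: dominated_smallM; first exact: bounded_cst.
exact: smallM.
Qed.

Let dD2_qd : dominated F qd (fun e => dD e ^+ 2).
Proof.
have H : dominated F qd (fun e => (dev e.2)^-1 * ((dev e.2)^-1 *
    (dw e ^+ 2 + (2 * (dw e * Z e) + (Z e * Z e + ds e * ds e)) - ds e * ds e))).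
  do 2 (apply: dominatedM; first exact: bounded_right cdevV).
  apply: dominatedB.
    by apply: dominatedD => //; exact: small_dominated.
  by apply: small_dominated; apply: (small_trans dt_qd); exact: smallM.
apply: (dominated_near _ H); near=> e.
have [ee e1 e2] : [/\ e.1 < e.2, e.1 < T & e.2 < T] by near: e.
have s0 : dev e.2 != 0 by rewrite gt_eqF ?dev_gt0.
have -> : dD e = (dw e + Z e) / dev e.2.
  by apply: (mulIf s0); rewrite divfK// mulrC; near: e; exact: dDE.
by field.
Unshelve. all: by end_near. Qed.

Let dE2_qd : dominated F qd (fun e => dE e ^+ 2).
Proof.
have H : dominated F qd (fun e => dD e ^+ 2 - (dD e + dE e) * ds e).
  apply: dominatedB => //; apply: small_dominated; apply: (small_trans dt_qd).
  by apply: smallM => //; exact: smallD.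
apply: (dominated_near _ H); apply: nearW => e.
by rewrite /dE /D2 /dD /ds; ring.
Qed.

(* The remainder of the second-order expansion of [stdN] at the right endpoint,
   where the derivative of the density is [- x * n(x)]. *)
Let rho (X : R -> R) (e : R * R) := stdN (X e.2) - stdN (X e.1)
  - n01 (X e.2) * (X e.2 - X e.1)
  + 2^-1 * (- X e.2 * n01 (X e.2)) * (X e.2 - X e.1) ^+ 2.

Let small_rho (X : R -> R) : {in `[u, v], continuous X} ->
  dominated F qd (fun e => (X e.2 - X e.1) ^+ 2) -> small F qd (rho X).
Proof.
move=> cX X2; apply: (small_trans X2).
have := @small_taylor2 _ u v X cX stdN n01 (fun x => - x * n01 x)
  (@is_derive_stdN R) (@is_derive_normal_pdf01 R); apply.
move=> x; apply: cvgM; first exact: cvgN.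
by apply: continuous_normal_pdf; rewrite oner_eq0.
Qed.

(** The Black-Scholes equation in discrete form.  Subtracting the two hedging
terms from the increment of [value] leaves exactly
[price * (N(D1 y) - N(D1 x)) - strike * (N(D2 y) - N(D2 x))], with [price] and
[strike] taken at the right endpoint [y].  Expanding [N] to second order at [y]
and using [price_normal_pdf] to pull out the common factor [g = price * n(D1)],
what remains is [g * (d dev + dev * (d D1) ^ 2 / 2)].  Since [dev * d D1] is the
increment of [w] up to drift and [dev * d dev] is [- sigma ^ 2 / 2] times the
time increment up to second order, the two leading terms form a multiple of
[(d w) ^ 2 - sigma ^ 2 * d t]. *)
Lemma ito_value : small F qd (fun e =>
  value e.2 - value e.1 - stdN (D1 e.1) * (price e.2 - price e.1)
  + stdN (D2 e.1) * (strike e.2 - strike e.1)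
  - 2^-1 * curvature e.2 * ((w e.2 - w e.1) ^+ 2 - sigma ^+ 2 * (e.2 - e.1))).
Proof.
have bhalf : bounded F (fun=> (2 : R)^-1) by exact: bounded_cst.
have bP : bounded F (fun e => price e.2).
  by apply: bounded_right => x _; exact: continuous_price.
have bk : bounded F (fun e => strike e.2).
  by apply: bounded_right => x _; exact: continuous_strike.
have bg : bounded F (fun e => price e.2 * n01 (D1 e.2)).
  by apply: dominatedM => //; apply: (bounded_right (cn cD1)).
have H : small F qd (fun e =>
    2^-1 * (curvature e.2 * (2 * (dw e * Z e) + (Z e * Z e + ds e * ds e))) +
    2^-1 * ((price e.2 * n01 (D1 e.2)) * (D2 e.2 * ((dD e + dE e) * ds e))) +
    price e.2 * rho D1 e - strike e.2 * rho D2 e).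
  apply: smallB; last by apply: dominated_smallM => //; exact: small_rho.
  apply: smallD; last by apply: dominated_smallM => //; exact: small_rho.
  apply: smallD; apply: dominated_smallM => //; apply: dominated_smallM => //.
    exact: bounded_right continuous_curvature.
  apply: dominated_smallM; first exact: bounded_right cD2.
  by apply: (small_trans dt_qd); apply: smallM => //; exact: smallD.
apply: (small_near _ H); near=> e; rewrite -/(dw e) -/(dt e).
have [ee e1 e2] : [/\ e.1 < e.2, e.1 < T & e.2 < T] by near: e.
have s0 : dev e.2 != 0 by rewrite gt_eqF ?dev_gt0.
have dwE : dw e = dev e.2 * dD e - Z e.
  by apply/eqP; rewrite -subr_eq opprK eq_sym; apply/eqP; near: e; exact: dDE.
have dtE : sigma ^+ 2 * dt e = (dev e.2 - ds e) ^+ 2 - dev e.2 ^+ 2.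
  by rewrite /ds subKr !dev_sqr ?ltW// /dt; ring.
have g0 := price_normal_pdf r w sigma0 K0 e2.
apply/eqP; rewrite -subr_eq0; apply/eqP.
(* The two sides differ by what results from writing [price * n(D1)] for
   [strike * n(D2)] in the expansion of [N(D2)]. *)
transitivity ((strike e.2 * n01 (D2 e.2) - price e.2 * n01 (D1 e.2)) *
  (dE e + 2^-1 * D2 e.2 * dE e ^+ 2)); last by rewrite g0 subrr mul0r.
rewrite dtE dwE /rho /value /curvature.
move: (Z e) (n01 (D2 e.2)) (stdN (D2 e.2)) (stdN (D2 e.1)) => z nE NEy NEx.
by rewrite /dE /dD /ds /D2; field.
Unshelve. all: by end_near. Qed.

End BlackScholesIto.

(** * Primitives on a half-open interval *)
Section Primitive.
Context {R : realType}.

(** The integral starts at [-1], to the left of the interval of interest, so that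
the primitive is differentiable on both sides of the origin. *)
Lemma primitive_left (T : R) (f : R -> R) : 0 < T ->
  (forall t, t < T -> {for t, continuous f}) ->
  exists2 F : R -> R, F 0 = 0 & forall t, 0 <= t -> t < T -> is_derive t 1 F (f t).
Proof.
move=> T0 cf.
pose G x := (\int[lebesgue_measure]_(t in `[(-1)%R, x]) f t)%R.
have dG t : 0 <= t -> t < T -> is_derive t 1 G (f t).
  move=> t0 tT; have tu : t < (t + T) / 2 by lra.
  have [|||dF F'] := continuous_FTC1_closed tu (f := f) (a := -1).
  - apply: continuous_compact_integrable; first exact: segment_compact.
    apply: continuous_in_subspaceT => x; rewrite inE /= in_itv /= => /andP[_ xt].
    by apply: cf; lra.
  - by lra.
  - exact: cf.
  by apply: DeriveDef; [exact: dF|rewrite -F' derive1E].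
exists (fun x => G x - G 0) => [|t t0 tT]; first by rewrite subrr.
by have := dG t t0 tT => dGt; apply: is_derive_eq; rewrite subr0.
Qed.

(** Monotonicity and boundedness replace a Cauchy argument. *)
Lemma cvg_left_bounded_derive (T C : R) (F f : R -> R) : 0 < T ->
  (forall t, 0 <= t -> t < T -> is_derive t 1 F (f t)) ->
  (forall t, 0 <= t -> t < T -> 0 <= f t <= C) ->
  cvg (F x @[x --> T^'-]).
Proof.
move=> T0 dF fC.
have incr x y : 0 <= x -> x <= y -> y < T -> 0 <= F y - F x <= C * (y - x).
  move=> x0 xy yT; have [|||z zxy ->] := @MVT_segment _ F f x y.
  - by [].
  - by move=> z; rewrite in_itv /= => /andP[xz zy]; apply: dF; lra.
  - apply: continuous_in_subspaceT => z; rewrite inE /= in_itv /= => /andP[xz zy].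
    have [||+ _] := dF z; [lra|lra|].
    by move=> /derivable1_diffP/differentiable_continuous.
  - move: zxy; rewrite in_itv /= => /andP[xz zy].
    have /andP[fz0 fzC] := fC z (le_trans x0 xz) (le_lt_trans zy yT).
    by rewrite mulr_ge0 ?ler_wpM2r// subr_ge0.
have C0 : 0 <= C by have /andP[] := fC 0 (lexx _) T0; exact: le_trans.
apply: nondecreasing_at_left_is_cvgr.
  near=> x; have x0 : 0 < x by near: x; exact: nbhs_left_gt.
  move=> a b; rewrite !in_itv /= => /andP[xa aT] /andP[xb bT] ab.
  by have /andP[] := incr a b (ltW (lt_trans x0 xa)) ab bT; rewrite subr_ge0.
near=> x; have x0 : 0 < x by near: x; exact: nbhs_left_gt.
exists (F 0 + C * T) => _ /= [y + <-].
rewrite in_itv /= => /andP[xy yT].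
have y0 := lt_trans x0 xy.
have /andP[_] := incr 0 y (lexx _) (ltW y0) yT.
rewrite subr0 lerBlDl => /le_trans; apply.
by rewrite lerD2l ler_wpM2l// ltW.
Unshelve. all: by end_near. Qed.

End Primitive.

(** * Convergence of the option value to the payoff *)
Section PayoffLimit.
Context {R : realType} (T sigma K r : R) (w : R -> R).
Hypotheses (sigma0 : 0 < sigma) (K0 : 0 < K).
Hypothesis cw : continuous w.
Local Notation price := (price sigma w).
Local Notation dev := (dev T sigma).
Local Notation strike := (strike T K r).
Local Notation D1 := (D1 T sigma K r w).
Local Notation D2 := (D2 T sigma K r w).
Local Notation value := (value T sigma K r w).

Let num t := w t - 2^-1 * (sigma ^+ 2 * t) - ln K + (r + sigma ^+ 2 / 2) * (T - t).

Let cvg_left (f : R -> R) : continuous f -> f x @[x --> T^'-] --> f T.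
Proof. by move=> cf; apply: cvg_at_left_filter; exact: cf. Qed.

Let devT : dev T = 0. Proof. by rewrite /dev subrr sqrtr0 mulr0. Qed.

Let strikeT : strike T = K.
Proof. by rewrite /strike subrr mulr0 oppr0 expR0 mulr1. Qed.

Let cvg_dev : dev x @[x --> T^'-] --> 0.
Proof. by rewrite -devT; apply: cvg_left; exact: continuous_dev. Qed.

Let cvg_devV : (dev x)^-1 @[x --> T^'-] --> +oo.
Proof.
apply/cvgrVy; last exact: cvg_dev.
by near=> x; apply: dev_gt0 => //; near: x; exact: nbhs_left_lt.
Unshelve. all: by end_near. Qed.

Let cvg_num : num x @[x --> T^'-] --> ln (price T / K).
Proof.
rewrite ln_div ?posrE ?price_gt0// expRK.
have -> : w T - 2^-1 * (sigma ^+ 2 * T) - ln K = num T.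
  by rewrite /num subrr mulr0 addr0.
apply: cvg_left => t; apply: cvgD.
  apply: cvgB; last exact: cvg_cst.
  by apply: cvgB; [exact: cw|apply: cvgMr; exact: cvgMr].
by apply: cvgMr; apply: cvgB => //; exact: cvg_cst.
Qed.

Let cvg_stdN1 (n : R -> R) (l : R) : n x @[x --> T^'-] --> l -> 0 < l ->
  stdN (n x / dev x) @[x --> T^'-] --> (1 : R).
Proof.
move=> nl l0; apply: cvg_comp (@cvg_stdNy R); have l20 : 0 < l / 2 by lra.
have H : l / 2 * (dev x)^-1 @[x --> T^'-] --> +oo by exact: gt0_cvgMry.
apply: ger_cvgy H.
near=> x; rewrite ler_wpM2r ?invr_ge0 ?mulr_ge0 ?sqrtr_ge0 ?(ltW sigma0)//.
by near: x; apply: (cvgr_ge _ nl); lra.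
Unshelve. all: by end_near. Qed.

Let cvg_stdN0 (n : R -> R) (l : R) : n x @[x --> T^'-] --> l -> l < 0 ->
  stdN (n x / dev x) @[x --> T^'-] --> (0 : R).
Proof.
move=> nl l0; apply: cvg_comp (@cvg_stdNNy R); have l20 : 0 < - l / 2 by lra.
have : - l / 2 * (dev x)^-1 @[x --> T^'-] --> +oo by exact: gt0_cvgMry.
have -> : (fun x => - l / 2 * (dev x)^-1) = - (fun x => l / 2 * (dev x)^-1).
  by apply/funext => x; rewrite fctE !mulNr.
move=> /cvgNry; apply: ler_cvgNy.
near=> x; rewrite ler_wpM2r ?invr_ge0 ?mulr_ge0 ?sqrtr_ge0 ?(ltW sigma0)//.
by near: x; apply: (cvgr_le _ nl); lra.
Unshelve. all: by end_near. Qed.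

Let D2E : \forall x \near T^'-, D2 x = (num x - dev x * dev x) / dev x.
Proof.
apply: filterS (nbhs_left_lt T) => x xT.
by rewrite mulrBl mulfK// gt_eqF ?dev_gt0.
Qed.

Let cvg_num2 : num x - dev x * dev x @[x --> T^'-] --> ln (price T / K).
Proof.
rewrite -[X in _ --> X]subr0 -[X in _ - X](mulr0 0).
by apply: cvgB cvg_num _; exact: cvgM.
Qed.

Let cvg_price : price x @[x --> T^'-] --> price T.
Proof. by apply: cvg_left; exact: continuous_price. Qed.

Let cvg_strike : strike x @[x --> T^'-] --> K.
Proof.
by rewrite -[X in _ --> X]strikeT; apply: cvg_left; exact: continuous_strike.
Qed.

Let cvg_value_of (l : R) : stdN (D1 x) @[x --> T^'-] --> l ->
  stdN ((num x - dev x * dev x) / dev x) @[x --> T^'-] --> l ->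
  value x @[x --> T^'-] --> price T * l - K * l.
Proof.
move=> l1 l2; apply: cvgB; apply: cvgM => //.
apply: cvg_trans l2; apply: near_eq_cvg; near=> x.
by congr (stdN _); near: x; apply: filterS D2E => x ->.
Unshelve. all: by end_near. Qed.

(** Away from the strike, [D1] and [D2] tend together to plus or minus infinity.
At the strike they may oscillate, but their distance [dev] tends to zero, and
so does the difference of price and strike that multiplies [N(D1)]. *)
Lemma cvg_value : value x @[x --> T^'-] --> Num.max 0 (price T - K).
Proof.
have [PK|KP|PK] := ltgtP (price T) K.
- have l0 : ln (price T / K) < 0.
    by rewrite ln_lt0// divr_gt0 ?price_gt0//= ltr_pdivrMr// mul1r.
  rewrite max_l; last by rewrite subr_le0 ltW.
  have := cvg_value_of (cvg_stdN0 cvg_num l0) (cvg_stdN0 cvg_num2 l0).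
  by rewrite !mulr0 subr0.
- have l0 : 0 < ln (price T / K).
    by rewrite ln_gt0// ltr_pdivlMr// mul1r.
  rewrite max_r; last by rewrite subr_ge0 ltW.
  have := cvg_value_of (cvg_stdN1 cvg_num l0) (cvg_stdN1 cvg_num2 l0).
  by rewrite !mulr1.
rewrite PK subrr maxxx; apply: norm_cvg0.
have bound : (`|price x - strike x| + strike x * (normal_peak 1 * dev x))
    @[x --> T^'-] --> (0 : R).
  have -> : (0 : R) = `|price T - K| + K * (normal_peak 1 * 0).
    by rewrite PK subrr normr0 !mulr0 addr0.
  apply: cvgD; first by apply: cvg_norm; exact: cvgB.
  by apply: cvgM => //; exact: cvgMr.
apply: (squeeze_cvgr _ (cvg_cst _) bound).
near=> x; rewrite normr_ge0 /=.
have -> : value x = (price x - strike x) * stdN (D1 x)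
    + strike x * (stdN (D1 x) - stdN (D2 x)).
  by rewrite /value; ring.
apply: (le_trans (ler_normD _ _)); apply: lerD.
  by rewrite normrM ler_piMr// ger0_norm ?stdN_ge0 ?stdN_le1.
have k0 : 0 <= strike x by rewrite mulr_ge0 ?expR_ge0 ?ltW.
have dev0 : 0 <= dev x by rewrite mulr_ge0 ?sqrtr_ge0 ?ltW.
rewrite normrM (ger0_norm k0); apply: ler_wpM2l => //.
have := stdN_lipschitz (D2 x) (D1 x).
by rewrite {3}/D2 subKr (ger0_norm dev0).
Unshelve. all: by end_near. Qed.

End PayoffLimit.

(** * Quadratic variation under perturbation by finite p-variation *)
Section QuadraticVariation.
Context {R : realType} (T : R) (lam : nat -> seq R).
Hypotheses (T0 : 0 < T) (lamL : Lambda T lam).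
Implicit Types (u v p : R) (f g h w : R -> R).

(** Composing with the retraction onto [[0, T]] replaces continuity within the
segment by continuity on the line, without changing the path on the segment. *)
Definition clamp (t : R) : R := Num.max 0 (Num.min t T).

Lemma clamp_id t : 0 <= t <= T -> clamp t = t.
Proof. by move=> /andP[t0 tT]; rewrite /clamp min_l// max_r. Qed.

Lemma clamp_itv t : clamp t \in `[0, T].
Proof.
by rewrite in_itv /= /clamp le_max lexx /= ge_max (ltW T0) ge_min lexx orbT.
Qed.

Lemma continuous_clamp : continuous clamp.
Proof.
move=> t; apply: (@continuous_max R R (fun=> 0) (fun x => Num.min x T)).
  exact: cvg_cst.
by apply: (@continuous_min R R id (fun=> T)); [exact: cvg_id|exact: cvg_cst].
Qed.

Lemma continuous_comp_clamp f : {within `[0, T], continuous f} ->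
  continuous (f \o clamp).
Proof.
move=> /subspace_continuousP cf t; apply: cvg_comp (cf _ (clamp_itv t)).
move=> U; rewrite /within /= => /(@continuous_clamp t) HU.
have : \forall x \near t, clamp x \in `[0, T] -> U (clamp x) by exact: HU.
suff: (\forall x \near t, clamp x \in `[0, T] -> U (clamp x)) ->
  \forall x \near t, U (clamp x) by [].
by apply: filterS => x; apply; exact: clamp_itv.
Qed.

(** Where the exponent [p < 2] enters: a squared increment is the [p]-th power of
its size times its [(2 - p)]-th power, and the latter is uniformly small by
continuity. *)
Lemma CW_quad0 p h u v : 1 <= p -> p < 2 -> CW T p h ->
  0 <= u -> u < v -> v <= T ->
  lam_sum lam u v (fun e => (h e.2 - h e.1) ^+ 2) @ \oo --> 0.
Proof.
move=> p1 p2 [ch [C hC]] u0 uv vT.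
have in0T e : u <= e.1 -> e.1 < e.2 -> e.2 <= v -> 0 <= e.1 <= T /\ 0 <= e.2 <= T.
  by move=> *; split; lra.
have vh : vanishing (fine_steps u v) (fun e => h e.2 - h e.1).
  have : vanishing (fine_steps u v) (fun e => (h \o clamp) e.2 - (h \o clamp) e.1).
    by apply: vanishing_increment => x _; exact: continuous_comp_clamp.
  apply: small_near; apply: filterS (near_fine_steps u v) => e [ue ee ev].
  by have [e1 e2] := in0T e ue ee ev; rewrite /= !clamp_id.
apply: (@lam_sum_small _ T lam lamL u v _ (fun e => `|h e.2 - h e.1| `^ p) C) => //.
  apply: nearW => m.
  (* The bound is on partitions of the whole segment, so the partition of
     [[u, v]] is completed by at most one point on either side. *)
  have [s1 p1s] : exists s, itv_partition 0 u s.
    case: (ltgtP 0 u) u0 => // [u0 _|<- _]; last by exists [::].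
    by exists [:: u]; exact: itv_partition1.
  have [s2 p2s] : exists s, itv_partition v T s.
    case: (ltgtP v T) vT => // [vT _|<- _]; last by exists [::].
    by exists [:: T]; exact: itv_partition1.
  have part := itv_partition_restr (Lambda_sorted lamL m) uv.
  have := hC _ (ex_intro2 _ _ _
    (itv_partition_cat p1s (itv_partition_cat part p2s)) erefl).
  rewrite pvar_sumE !steps_cat (eqP p1s.2) (eqP part.2) !big_cat /=.
  apply: le_trans; rewrite addrCA lerDl.
  by rewrite addr_ge0// sumr_ge0// => e _; exact: powR_ge0.
move=> eps eps0; have q0 : 0 < 2 - p by lra.
(* chosen so that its [(2 - p)]-th power is [eps] *)
have d0 : 0 < eps `^ (2 - p)^-1 by rewrite powR_gt0.
apply: filterS (vh _ d0) => e; rewrite mulr1 => he.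
rewrite normrX -powR_mulrn//.
have -> : 2%:R = (2 - p) + p :> R by rewrite subrK.
rewrite powRD; last by rewrite subrK pnatr_eq0.
rewrite ler_wpM2r ?powR_ge0//.
have -> : eps = (eps `^ (2 - p)^-1) `^ (2 - p).
  by rewrite -powRrM mulVf ?powRr1 ?gt_eqF// ltW.
by apply: ge0_ler_powR; rewrite ?nnegrE ?powR_ge0 ?(ltW q0).
Qed.

(** The cross terms are controlled by the weighted arithmetic-geometric
inequality [2 a b <= eta a ^ 2 + b ^ 2 / eta], with a fixed small [eta]. *)
Lemma quad_sum_add g h u v (l : R) : 0 <= u -> u < v -> v <= T ->
  lam_sum lam u v (fun e => (g e.2 - g e.1) ^+ 2) @ \oo --> l ->
  lam_sum lam u v (fun e => (h e.2 - h e.1) ^+ 2) @ \oo --> 0 ->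
  lam_sum lam u v (fun e => ((g e.2 + h e.2) - (g e.1 + h e.1)) ^+ 2) @ \oo --> l.
Proof.
move=> u0 uv vT gl h0.
pose cross := lam_sum lam u v (fun e => 2 * ((g e.2 - g e.1) * (h e.2 - h e.1))).
have cross0 : cross @ \oo --> 0.
  apply/cvgr0Pnorm_le => eps eps0.
  have l0 : 0 < `|l| + 1 by rewrite ltr_wpDl.
  pose eta := eps / 2 / (`|l| + 1).
  have eta0 : 0 < eta by rewrite !divr_gt0.
  have etaV : 0 < eps / 2 * eta by rewrite mulr_gt0// divr_gt0.
  near=> m.
  have H1 : lam_sum lam u v (fun e => (g e.2 - g e.1) ^+ 2) m <= `|l| + 1.
    near: m; apply: (cvgr_le _ gl); apply: le_lt_trans (ler_norm _) _.
    by rewrite ltrDl.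
  have H2 : lam_sum lam u v (fun e => (h e.2 - h e.1) ^+ 2) m <= eps / 2 * eta.
    by near: m; apply: (cvgr_le _ h0).
  have H3 : `|cross m| <= lam_sum lam u v
      (fun e => eta * (g e.2 - g e.1) ^+ 2 + eta^-1 * (h e.2 - h e.1) ^+ 2) m.
    near: m; apply: (lam_sum_norm_le lamL) => //; apply: nearW => e.
    rewrite !normrM (@ger0_norm _ 2)// -(real_normK (num_real (g _ - _))).
    rewrite -(real_normK (num_real (h _ - _))).
    move: `|g e.2 - g e.1| `|h e.2 - h e.1| => a b; rewrite -subr_ge0.
    have -> : eta * a ^+ 2 + eta^-1 * b ^+ 2 - 2 * (a * b)
        = eta * (a - b / eta) ^+ 2.
      by field; rewrite gt_eqF.
    by rewrite mulr_ge0 ?sqr_ge0 ?ltW.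
  apply: (le_trans H3); rewrite lam_sumD !lam_sumZ.
  have : eta * (`|l| + 1) = eps / 2 by rewrite /eta divfK// gt_eqF.
  have := ler_wpM2l (ltW eta0) H1.
  have etaV0 : 0 <= eta^-1 by rewrite invr_ge0 ltW.
  have := ler_wpM2l etaV0 H2; rewrite mulrCA mulVf ?gt_eqF// mulr1.
  by lra.
have : (fun m => lam_sum lam u v (fun e => (g e.2 - g e.1) ^+ 2) m + cross m +
    lam_sum lam u v (fun e => (h e.2 - h e.1) ^+ 2) m) @ \oo --> l + 0 + 0.
  by apply: cvgD => //; exact: cvgD.
rewrite !addr0; apply: cvg_trans; apply: near_eq_cvg; apply: nearW => m.
by rewrite /cross -!lam_sumD; apply: eq_bigr => e _; ring.
Unshelve. all: by end_near. Qed.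

End QuadraticVariation.

(** * Price scenarios as exponentials of globally continuous paths *)
Section XclassPath.
Context {R : realType} (T p sigma : R) (lam : nat -> seq R).
Hypotheses (T0 : 0 < T) (lamL : Lambda T lam) (p1 : 1 <= p) (p2 : p < 2).

(** Uniqueness of limits determines brackets on [[0, T]], so the arbitrary choice
in [qbracket] is immaterial there. *)
Lemma qbracketE w (H : R -> R) t : is_qvar T lam w H -> 0 <= t <= T ->
  qbracket T lam w t = H t.
Proof.
move=> wH /andP[t0 tT].
have [q0 wq] : is_qvar T lam w (qbracket T lam w).
  exact: (@xgetPex _ _ [set G | is_qvar T lam w G]) (ex_intro _ H wH).
have [-> | t_neq0] := eqVneq t 0; first by rewrite q0 wH.1.
have tpos : 0 < t by rewrite lt_neqAle eq_sym t_neq0.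
have : qbracket T lam w t - qbracket T lam w 0 = H t - H 0.
  exact: cvg_unique (wq 0 t (lexx _) tpos tT) (wH.2 0 t (lexx _) tpos tT).
by rewrite q0 wH.1 !subr0.
Qed.

Lemma Xclass_path w : Xclass T lam p sigma w ->
  exists w' : R -> R, [/\ continuous w', {in `[0, T], w' =1 w},
    forall u v, 0 <= u -> u < v -> v <= T ->
      lam_sum lam u v (fun e => (w' e.2 - w' e.1) ^+ 2) @ \oo -->
        sigma ^+ 2 * (v - u) &
    forall t, 0 <= t <= T -> qbracket T lam w t = sigma ^+ 2 * t].
Proof.
move=> [g [h [[cg [_ qg]] hCW g0 h0 wE]]].
pose w' := (g \o clamp T) \+ (h \o clamp T).
have w'E : {in `[0, T], w' =1 w}.
  by move=> t; rewrite in_itv /= => tT; rewrite /w' /= clamp_id// -wE.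
have qw' u v : 0 <= u -> u < v -> v <= T ->
    lam_sum lam u v (fun e => (w' e.2 - w' e.1) ^+ 2) @ \oo -->
      sigma ^+ 2 * (v - u).
  move=> u0 uv vT.
  have qg' : lam_sum lam u v (fun e => (g e.2 - g e.1) ^+ 2) @ \oo -->
      sigma ^+ 2 * (v - u).
    have := qg u v u0 uv vT; rewrite mulrBr; apply: cvg_trans.
    by apply: near_eq_cvg; apply: nearW => m; rewrite quad_sumE.
  have := quad_sum_add lamL u0 uv vT qg' (CW_quad0 T0 lamL p1 p2 hCW u0 uv vT).
  apply: cvg_trans; apply: near_eq_cvg; apply: (lam_sum_eq lamL) => //.
  apply: filterS (near_fine_steps u v) => e [ue ee ev].
  by rewrite /w' /= !clamp_id//; apply/andP; split; lra.
exists w'; split => //.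
  by move=> t; apply: cvgD; apply: continuous_comp_clamp => //; exact: hCW.1.
move=> t tT; rewrite (@qbracketE w (fun t => sigma ^+ 2 * t))//.
split=> [|u v u0 uv vT]; first by rewrite mulr0.
rewrite -mulrBr; apply: cvg_trans (qw' u v u0 uv vT); apply: near_eq_cvg.
near=> m; rewrite quad_sumE; near: m.
apply: (lam_sum_eq lamL) => //.
apply: filterS (near_fine_steps u v) => e [ue ee ev].
by rewrite !w'E// in_itv /=; apply/andP; split; lra.
Unshelve. all: by end_near. Qed.

End XclassPath.

(** * Left Cauchy integrals from local expansions *)
Section LeftCauchy.
Context {R : realType} (T : R) (lam : nat -> seq R).
Hypotheses (T0 : 0 < T) (lamL : Lambda T lam).
Implicit Types (gamma S Phi : R -> R) (u v t : R).

Lemma is_LC_continuous gamma S Phi : Phi 0 = 0 ->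
  (forall t, 0 <= t < T -> {for t, continuous Phi}) ->
  (forall u v, 0 <= u -> u < v -> v < T ->
     lam_sum lam u v (fun e => gamma e.1 * (S e.2 - S e.1)) @ \oo -->
       Phi v - Phi u) ->
  is_LC T lam gamma S Phi.
Proof.
move=> Phi0 cPhi sums.
have cR t : 0 <= t < T -> Phi x @[x --> t^'+] --> Phi t.
  by move=> tT; apply: cvg_at_right_filter; exact: cPhi.
have cL t : 0 < t < T -> Phi x @[x --> t^'-] --> Phi t.
  move=> /andP[t0 tT]; apply: cvg_at_left_filter; apply: cPhi.
  by rewrite (ltW t0).
split=> //.
- by split=> t tT; [apply: cvgP (cR t tT)|apply: cvgP (cL t tT)].
- move=> u v u0 uv vT; have := sums u v u0 uv vT; apply: cvg_trans.
  by apply: near_eq_cvg; apply: nearW => m; rewrite LC_sumE.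
Qed.

(** As for brackets, uniqueness of limits identifies the chosen integral. *)
Lemma LC_intE gamma S Phi t : is_LC T lam gamma S Phi -> 0 <= t -> t < T ->
  LC_int T lam gamma S t = Phi t.
Proof.
move=> PhiLC t0 tT.
have [_ I0 _ sumI] : is_LC T lam gamma S (LC_int T lam gamma S).
  exact: (@xgetPex _ _ [set Phi | is_LC T lam gamma S Phi]) (ex_intro _ Phi PhiLC).
have [_ Phi0 _ sumPhi] := PhiLC.
have [-> | t_neq0] := eqVneq t 0; first by rewrite I0 Phi0.
have tpos : 0 < t by rewrite lt_neqAle eq_sym t_neq0.
have : LC_int T lam gamma S t - LC_int T lam gamma S 0 = Phi t - Phi 0.
  exact: cvg_unique (sumI 0 t (lexx _) tpos tT) (sumPhi 0 t (lexx _) tpos tT).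
by rewrite I0 Phi0 !subr0.
Qed.

Lemma cvg_LC_int gamma S Phi (l : R) : is_LC T lam gamma S Phi ->
  Phi x @[x --> T^'-] --> l -> LC_int T lam gamma S x @[x --> T^'-] --> l.
Proof.
move=> PhiLC; apply: cvg_trans; apply: near_eq_cvg; near=> x.
have x0 : 0 <= x by near: x; exact: nbhs_left_ge.
have xT : x < T by near: x; exact: nbhs_left_lt.
by rewrite (LC_intE PhiLC).
Unshelve. all: by end_near. Qed.

Lemma LC_integralT gamma S Phi (l : R) : is_LC T lam gamma S Phi ->
  Phi x @[x --> T^'-] --> l -> LC_integral T lam gamma S T = l.
Proof.
move=> PhiLC /(cvg_LC_int PhiLC) Il; rewrite /LC_integral ltxx.
exact: cvg_lim Il.
Qed.

Section SumLimit.
Context (sigma : R) (w : R -> R).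
Hypothesis qw : forall u v, 0 <= u -> u < v -> v <= T ->
  lam_sum lam u v (fun e => (w e.2 - w e.1) ^+ 2) @ \oo --> sigma ^+ 2 * (v - u).

Lemma lam_sum_qd u v : 0 <= u -> u < v -> v <= T ->
  lam_sum lam u v (qd w) @ \oo --> (sigma ^+ 2 + 1) * (v - u).
Proof.
move=> u0 uv vT; rewrite mulrDl mul1r.
have : (fun m => lam_sum lam u v (fun e => (w e.2 - w e.1) ^+ 2) m + (v - u))
    @ \oo --> sigma ^+ 2 * (v - u) + (v - u).
  by apply: cvgD; [exact: qw|exact: cvg_cst].
apply: cvg_trans; apply: near_eq_cvg; apply: nearW => m.
by rewrite /qd lam_sumD (@lam_sum_telescope _ _ _ _ id).
Qed.

(** The discrete noise [(d w) ^ 2 - sigma ^ 2 d t] has vanishing sums on every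
subinterval, hence also when weighted by a continuous function. *)
Lemma lam_sum_bracket0 u v (f : R -> R) : 0 <= u -> u < v -> v <= T ->
  {in `[u, v], continuous f} ->
  lam_sum lam u v
    (fun e => f e.2 * ((w e.2 - w e.1) ^+ 2 - sigma ^+ 2 * (e.2 - e.1)))
    @ \oo --> 0.
Proof.
move=> u0 uv vT cf.
have drift a b m : lam_sum lam a b (fun e => sigma ^+ 2 * (e.2 - e.1)) m =
    sigma ^+ 2 * (b - a).
  by rewrite lam_sumZ (@lam_sum_telescope _ _ _ _ id).
apply: (@lam_sum_weighted _ T lam lamL u v (2 * sigma ^+ 2) f _
  (fun e => (w e.2 - w e.1) ^+ 2 + sigma ^+ 2 * (e.2 - e.1))) => //.
- apply: filterS (near_fine_steps u v) => e [_ ee _].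
  rewrite (le_trans (ler_normB _ _))// !ger0_norm ?sqr_ge0//.
  by rewrite mulr_ge0 ?sqr_ge0// subr_ge0 ltW.
- move=> a b ua ab bv.
  have := qw (le_trans u0 ua) ab (le_trans bv vT) => qab.
  have : (fun m => lam_sum lam a b (fun e => (w e.2 - w e.1) ^+ 2) m -
      sigma ^+ 2 * (b - a)) @ \oo --> sigma ^+ 2 * (b - a) - sigma ^+ 2 * (b - a).
    by apply: cvgB => //; exact: cvg_cst.
  rewrite subrr; apply: cvg_trans; apply: near_eq_cvg; apply: nearW => m.
  rewrite lam_sumD -(drift a b m); congr (_ + _).
  by rewrite /lam_sum -sumrN.
- move=> a b ua ab bv.
  have := qw (le_trans u0 ua) ab (le_trans bv vT) => qab.
  have : (fun m => lam_sum lam a b (fun e => (w e.2 - w e.1) ^+ 2) m +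
      sigma ^+ 2 * (b - a)) @ \oo --> sigma ^+ 2 * (b - a) + sigma ^+ 2 * (b - a).
    by apply: cvgD => //; exact: cvg_cst.
  rewrite -mulrA (mulr_natl _ 2) mulr2n; apply: cvg_trans.
  apply: near_eq_cvg; apply: nearW => m.
  by rewrite lam_sumD drift.
Qed.

(** The criterion applied to both assets: the increments of [Phi] telescope,
while weighted noise and errors small with respect to [qd] sum to zero. *)
Lemma lam_sum_increment u v (A : R * R -> R) (Phi f : R -> R) :
  0 <= u -> u < v -> v <= T -> {in `[u, v], continuous f} ->
  small (fine_steps u v) (qd w) (fun e => Phi e.2 - Phi e.1 - A e
    - f e.2 * ((w e.2 - w e.1) ^+ 2 - sigma ^+ 2 * (e.2 - e.1))) ->
  lam_sum lam u v A @ \oo --> Phi v - Phi u.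
Proof.
move=> u0 uv vT cf sA.
have bd : \forall m \near \oo,
    lam_sum lam u v (qd w) m <= (sigma ^+ 2 + 1) * (v - u) + 1.
  by apply: (cvgr_le _ (lam_sum_qd u0 uv vT)); rewrite ltrDl.
pose rem e := Phi e.2 - Phi e.1 - A e
    - f e.2 * ((w e.2 - w e.1) ^+ 2 - sigma ^+ 2 * (e.2 - e.1)).
pose bracket e := f e.2 * ((w e.2 - w e.1) ^+ 2 - sigma ^+ 2 * (e.2 - e.1)).
have : (fun m => Phi v - Phi u - lam_sum lam u v rem m - lam_sum lam u v bracket m)
    @ \oo --> Phi v - Phi u - 0 - 0.
  apply: cvgB; last exact: lam_sum_bracket0.
  apply: cvgB; first exact: cvg_cst.
  exact: (lam_sum_small lamL u0 uv vT bd sA).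
rewrite !subr0; apply: cvg_trans; apply: near_eq_cvg; apply: nearW => m.
rewrite -(@lam_sum_telescope _ lam u v Phi m) /lam_sum -!sumrB.
by apply: eq_bigr => e _; rewrite /rem /bracket; ring.
Qed.

End SumLimit.
End LeftCauchy.

(** * The hedging strategy *)
Section SelfFinancing.
Context {R : realType} (T sigma K r : R) (lam : nat -> seq R) (w P : R -> R).
Hypotheses (T0 : 0 < T) (lamL : Lambda T lam).
Hypotheses (sigma0 : 0 < sigma) (K0 : 0 < K) (r0 : 0 < r).
Hypothesis cw : continuous w.
Hypothesis qw : forall u v, 0 <= u -> u < v -> v <= T ->
  lam_sum lam u v (fun e => (w e.2 - w e.1) ^+ 2) @ \oo --> sigma ^+ 2 * (v - u).
Local Notation price := (price sigma w).
Local Notation strike := (strike T K r).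
Local Notation D1 := (D1 T sigma K r w).
Local Notation D2 := (D2 T sigma K r w).
Local Notation value := (value T sigma K r w).
Local Notation alpha := (bs_alpha T K r sigma P).
Local Notation beta := (bs_beta T K r sigma P).
Hypothesis PE : {in `[0, T], P =1 price}.

Let P_price t : 0 <= t -> t <= T -> P t = price t.
Proof. by move=> t0 tT; apply: PE; rewrite in_itv /= t0. Qed.

Lemma bs_betaE t : 0 <= t -> t < T -> beta t = stdN (D1 t).
Proof.
by move=> t0 tT; rewrite /bs_beta tT P_price ?(ltW tT)// d1_price.
Qed.

Lemma bs_phiE t : 0 <= t -> t < T -> bs_phi T K r sigma t (P t) = value t.
Proof.
move=> t0 tT; rewrite P_price ?(ltW tT)// /bs_phi tT leNgt price_gt0 /=.
by rewrite d1_price// d2_price.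
Qed.

Lemma bs_phiT : bs_phi T K r sigma T (P T) = Num.max 0 (price T - K).
Proof. by rewrite P_price ?(ltW T0)// /bs_phi ltxx leNgt price_gt0. Qed.

Lemma portfolio_valueE t : portfolio_value alpha beta (bond r) P t =
  bs_phi T K r sigma t (P t).
Proof.
rewrite /portfolio_value /bs_alpha divfK; last by rewrite gt_eqF// expR_gt0.
by rewrite mulrC subrK.
Qed.

(** The discounted strike is a constant multiple of the bond, so the gain of the
cash position over a step is exactly a multiple of the increment of [strike]. *)
Lemma bs_alpha_bond x y : 0 <= x -> x < T ->
  alpha x * (bond r y - bond r x) = - stdN (D2 x) * (strike y - strike x).
Proof.
move=> x0 xT; rewrite /bs_alpha bs_phiE// bs_betaE// P_price ?(ltW xT)//.
have kE t : strike t = K * expR (- (r * T)) * bond r t.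
  by rewrite /strike /bond -mulrA -expRD; congr (_ * expR _); ring.
have b0 : bond r x != 0 by rewrite gt_eqF// expR_gt0.
rewrite !kE /value kE; field.
exact: b0.
Qed.

Lemma is_derive_strike (t : R) : is_derive t 1 strike (r * strike t).
Proof. by rewrite /strike; apply: is_derive_eq; rewrite /GRing.scale /=; field. Qed.

(** Both gains involve the same integral [Psi] of [r * strike * N(D2)] with
respect to time: the cash position loses it, and by [ito_value] the stock
position earns it on top of the variation of [value].  It cancels in the sum.
Being the primitive of a bounded nonnegative function, it has a finite limit [l]
at [T], which makes each of the two gains converge separately. *)
Lemma bs_gains : exists Phi0 Phi1 : R -> R, exists l : R,
  [/\ is_LC T lam alpha (bond r) Phi0, is_LC T lam beta P Phi1,
      forall t, Phi0 t + Phi1 t = value t - value 0,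
      Phi0 x @[x --> T^'-] --> - l &
      Phi1 x @[x --> T^'-] --> Num.max 0 (price T - K) - value 0 + l].
Proof.
pose f t := r * strike t * stdN (D2 t).
have cf t : t < T -> {for t, continuous f}.
  move=> tT; apply: cvgM; last exact: continuous_ND2.
  by apply: cvgMr; exact: continuous_strike.
have [Psi Psi0 dPsi] := primitive_left T0 cf.
have cPsi t : 0 <= t < T -> {for t, continuous Psi}.
  move=> /andP[t0 tT]; have [+ _] := dPsi t t0 tT.
  by move=> /derivable1_diffP/differentiable_continuous.
have [l Psil] : exists l : R, Psi x @[x --> T^'-] --> l.
  suff /cvg_ex : cvg (Psi x @[x --> T^'-]) by [].
  apply: (@cvg_left_bounded_derive _ T (r * K) Psi f T0 dPsi) => t t0 tT.
  have k0 := strike_gt0 T r K0 t.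
  have kK : strike t <= K.
    rewrite ler_piMr ?(ltW K0)// expR_le1 oppr_le0.
    by rewrite mulr_ge0 ?(ltW r0)// subr_ge0 ltW.
  have rk0 : 0 <= r * strike t by rewrite mulr_ge0 ?ltW.
  rewrite /f mulr_ge0 ?stdN_ge0//= -[leRHS]mulr1.
  by apply: ler_pM; rewrite ?stdN_ge0 ?stdN_le1// ler_pM2l.
have in0T u v x : 0 <= u -> v < T -> x \in `[u, v] -> 0 <= x /\ x < T.
  by move=> u0 vT; rewrite in_itv /= => /andP[ux xv]; split; lra.
have small_cash u v : 0 <= u -> v < T -> small (fine_steps u v) (qd w)
    (fun e => Psi e.2 - Psi e.1 - stdN (D2 e.1) * (strike e.2 - strike e.1)).
  move=> u0 vT; apply: (small_trans (dt_qd w u v)).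
  have H : small (fine_steps u v) (fun e => e.2 - e.1) (fun e =>
      (Psi e.2 - Psi e.1 - f e.1 * (e.2 - e.1)) - stdN (D2 e.1) *
      (strike e.2 - strike e.1 - r * strike e.1 * (e.2 - e.1))).
    apply: smallB.
      have dPsi' x : x \in `[u, v] -> is_derive x 1 Psi (f x).
        by move=> /(in0T _ _ _ u0 vT)[x0 xT]; exact: dPsi.
      refine (small_first_order dPsi' _) => x /(in0T _ _ _ u0 vT)[x0 xT].
      exact: cf.
    apply: dominated_smallM.
      apply: (bounded_left (f := fun t => stdN (D2 t))) => x xuv.
      have [x0 xT] := in0T _ _ _ u0 vT xuv.
      exact: continuous_ND2.
    refine (small_first_order (fun x _ => is_derive_strike x) _) => x _.
    by apply: cvgMr; exact: continuous_strike.
  by apply: (small_near _ H); apply: nearW => e; rewrite /f; ring.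
exists (fun t => - Psi t), (fun t => value t - value 0 + Psi t), l; split.
- apply: is_LC_continuous => //; first by rewrite Psi0 oppr0.
    by move=> t tT; apply: cvgN; exact: cPsi.
  move=> u v u0 uv vT.
  apply: (lam_sum_increment lamL qw (f := fun=> 0) (Phi := fun t => - Psi t)) => //.
  + exact: ltW.
  + by move=> x _; exact: cvg_cst.
  apply: (small_near _ (smallN (small_cash u v u0 vT))).
  apply: filterS (near_fine_steps u v) => e [ue ee ev].
  have e0 : 0 <= e.1 by exact: le_trans ue.
  have eT : e.1 < T by exact: lt_trans ee (le_lt_trans ev vT).
  by rewrite bs_alpha_bond//; ring.
- apply: is_LC_continuous => //; first by rewrite Psi0 subrr addr0.
    move=> t tT; apply: cvgD; last exact: cPsi.
    apply: cvgB; last exact: cvg_cst.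
    by apply: continuous_value => //; case/andP: tT.
  move=> u v u0 uv vT.
  apply: (lam_sum_increment lamL qw (f := fun t => 2^-1 * curvature T sigma K r w t)
    (Phi := fun t => value t - value 0 + Psi t)) => //.
  + exact: ltW.
  + by move=> x xuv; apply: cvgMr; exact: (continuous_curvature sigma0 cw vT xuv).
  have Hito := ito_value r sigma0 K0 cw u vT.
  apply: (small_near _ (smallD Hito (small_cash u v u0 vT))).
  apply: filterS (near_fine_steps u v) => e [ue ee ev].
  have e0 : 0 <= e.1 by exact: le_trans ue.
  have e1T : e.1 < T by exact: lt_trans ee (le_lt_trans ev vT).
  rewrite bs_betaE// !P_price; [ring| | | |]; lra.
- by move=> t; ring.
- exact: cvgN.
- apply: cvgD => //; apply: cvgB; last exact: cvg_cst.
  exact: cvg_value.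
Qed.

Lemma bs_trading_strategy_self_financing :
  trading_strategy T lam alpha beta (bond r) P /\
  self_financing T lam alpha beta (bond r) P.
Proof.
have [Phi0 [Phi1 [l [LC0 LC1 sumPhi lim0 lim1]]]] := bs_gains.
split.
  split; split.
  - apply: continuous_subspaceT => t; apply: continuous_comp.
      exact: cvgMr.
    exact: continuous_expR.
  - by exists Phi0.
  - exact: cvgP (cvg_LC_int T0 LC0 lim0).
  - apply: (@subspace_eq_continuous _ _ _ price).
      by move=> t; rewrite inE => /PE.
    by apply: continuous_subspaceT; exact: continuous_price.
  - by exists Phi1.
  - exact: cvgP (cvg_LC_int T0 LC1 lim1).
move=> t /andP[t0]; rewrite le_eqVlt => /predU1P[->|tT]; rewrite !portfolio_valueE.
  rewrite bs_phiT /portfolio_gain (LC_integralT T0 LC0 lim0).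
  rewrite (LC_integralT T0 LC1 lim1).
  by rewrite (bs_phiE (lexx _) T0); ring.
rewrite !bs_phiE// /portfolio_gain /LC_integral tT.
by rewrite (LC_intE LC0)// (LC_intE LC1)// sumPhi; ring.
Qed.

End SelfFinancing.

Theorem theorem13 (R : realType) (T p sigma K r : R) (lam : nat -> seq R)
    (X : set (R -> R)) :
  0 < T -> Lambda T lam -> 1 <= p -> p < 2 -> 0 < sigma -> 0 < K -> 0 < r ->
  X `<=` Xclass T lam p sigma ->
  forall P : R -> R, (doleans T lam @` X) P ->
    trading_strategy T lam
      (bs_alpha T K r sigma P) (bs_beta T K r sigma P) (bond r) P /\
    self_financing T lam
      (bs_alpha T K r sigma P) (bs_beta T K r sigma P) (bond r) P.
Proof.
move=> T0 lamL p1 p2 sigma0 K0 r0 XX P [w /XX wX <-].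
have [w' [cw' w'E qw' bracket]] := Xclass_path T0 lamL p1 p2 wX.
apply: (@bs_trading_strategy_self_financing _ _ _ _ _ _ w') => // t tT.
by rewrite /doleans /price w'E// bracket.
Qed.
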